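(* Let $p$ be a prime, $K_0/\mathbb{Q}_p$ a finite extension with uniformizer $\pi$ and residue field $k_0$, $K/K_0$ finite unramified, $L/K$ finite, and $M/L$ a finite unramified extension with Galois group of order $p^m$. Let $F$ be a Honda formal group over $\mathcal{O}_K$ relative to $K/K_0$ and $\pi$, of height $h$, and suppose $W_F\cap F(\mathfrak{p}_L)=W_F\cap F(\mathfrak{p}_M)=W^s_F$ for some $s\ge1$. Let $\zeta_1,\dots,\zeta_h$ be a basis of the $\mathcal{O}_{K_0}/\pi^s\mathcal{O}_{K_0}$-module $W^s_F$ (which is free of rank $h$). Then the images of $\zeta_1,\dots,\zeta_h$ in $F(\mathfrak{p}_L)/[\pi]_F(F(\mathfrak{p}_L))$ are linearly independent over $k_0$ modulo $\ker\phi$, where $\phi:F(\mathfrak{p}_L)/[\pi]_F(F(\mathfrak{p}_L))\to F(\mathfrak{p}_M)/[\pi]_F(F(\mathfrak{p}_M))$ is the map induced by inclusion; equivalently, the images of the $\zeta_i$ in $F(\mathfrak{p}_M)/[\pi]_F(F(\mathfrak{p}_M))$ are $k_0$-linearly independent.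
   Context: Honda formal groups: let $q=|k_0|$ and $\varphi$ the Frobenius of $K/K_0$. $\mathcal{O}_{K,\varphi}[[T]]$ is the noncommutative power series ring with $Ta=\varphi(a)T$, acting on $K[[X]]$ by $T*g(X)=g^{\varphi}(X^q)$. A type is $u=\pi+\sum_{i\ge1}a_iT^i$, $a_i\in\mathcal{O}_K$, of height $h$ = least $i$ with $a_i$ a unit. A one-dimensional formal group $F$ over $\mathcal{O}_K$ with logarithm $f$ is Honda of type $u$ if $u*f\equiv0\pmod\pi$; its height is that of $u$. There is an embedding $\mathcal{O}_{K_0}\hookrightarrow\mathrm{End}_{\mathcal{O}_K}(F)$, $a\mapsto[a]_F$, $f\circ[a]_F=af$. $F(\mathfrak{p}_E)$ is the maximal ideal of $\mathcal{O}_E$ with group law $F(x,y)$, an $\mathcal{O}_{K_0}$-module via $[a]_F$. $W^k_F=\{x\in\mathfrak{p}_{K^{\mathrm{alg}}}:[\pi^k]_F(x)=0\}$, $W_F=\bigcup_k W^k_F$. *)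

(* Defs.v *)
From HB Require Import structures.
From mathcomp Require Import all_boot all_order all_algebra all_field.
From mathcomp Require Export mpoly.
From Stdlib Require Export ClassicalEpsilon.

Set Implicit Arguments.
Unset Strict Implicit.
Unset Printing Implicit Defensive.

Import Order.TTheory GRing.Theory Num.Theory.
Local Open Scope ring_scope.

(* A valuation is a function w : E -> rat whose value at 0 is irrelevant:
   every definition below treats 0 as having valuation +oo. *)
Section Valuations.
Variables (E : fieldType) (w : E -> rat).

Definition is_valuation : Prop :=
  (forall x y, x != 0 -> y != 0 -> w (x * y) = w x + w y) /\
  (forall x y, x != 0 -> y != 0 -> x + y != 0 ->
     Num.min (w x) (w y) <= w (x + y)).

Definition val_ge (c : rat) (x : E) : bool := (x == 0) || (c <= w x).

Definition in_O (x : E) : bool := val_ge 0 x.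
Definition in_p (x : E) : bool := (x == 0) || (0 < w x).
Definition unit_O (x : E) : bool := (x != 0) && (w x == 0).

Definition uniformizer (pi : E) : Prop :=
  [/\ pi != 0, in_p pi & forall x, in_p x -> in_O (x / pi)].

Definition v_cvg (s : nat -> E) (l : E) : Prop :=
  forall c : rat, exists n0, forall n, (n0 <= n)%N -> val_ge c (s n - l).

Definition v_cauchy (s : nat -> E) : Prop :=
  forall c : rat, exists n0, forall m n,
    (n0 <= m)%N -> (n0 <= n)%N -> val_ge c (s m - s n).

Definition v_complete : Prop :=
  forall s, v_cauchy s -> exists l, v_cvg s l.

(* k is the residue field of w, with reduction map red; the values of red
   outside the valuation ring are irrelevant. *)
Definition is_residue_field (k : finFieldType) (red : E -> k) : Prop :=
  [/\ red 1 = 1,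
      forall x y, in_O x -> in_O y -> red (x + y) = red x + red y,
      forall x y, in_O x -> in_O y -> red (x * y) = red x * red y,
      forall c, exists2 x, in_O x & red x = c
    & forall x, in_O x -> (red x == 0) = in_p x].

End Valuations.

(* (E, w) is the completion of the rationals for the p-adic valuation. *)
Definition is_Qp (p : nat) (E : fieldType) (w : E -> rat) : Prop :=
  [/\ is_valuation w,
      forall n : nat, (0 < n)%N ->
        n%:R != 0 :> E /\ w n%:R = (logn p n)%:R,
      forall (x : E) (c : rat), exists r : rat, val_ge w c (x - ratr r)
    & v_complete w].

(* Ramification index 1, i.e. equal value groups.  The residue fields of all
   fields considered here are finite, so separability of the residue extension
   is automatic. *)
Definition unramified (A B : fieldType) (wA : A -> rat) (wB : B -> rat) : Prop :=
  forall y : B, y != 0 -> exists2 x : A, x != 0 & wA x = wB y.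

Definition emb (A : fieldType) (B : fieldExtType A) (C : fieldType)
  (j : {rmorphism B -> C}) : {rmorphism A -> C} := j \o in_alg B.

(* A power series in n variables is its family of coefficients. *)
Definition mps (n : nat) (A : Type) := 'X_{1..n} -> A.

Section PowerSeries.
Variable A : fieldType.

Definition mps_trunc (n : nat) (N : nat) (g : mps n A) : {mpoly A[n]} :=
  \sum_(m : 'X_{1..n < N}) g m *: 'X_[m].

(* Substitution of series without constant term: the coefficient at m only
   depends on the terms of total degree at most mdeg m. *)
Definition mps_comp (n k : nat) (g : mps n A) (hs : 'I_n -> mps k A) : mps k A :=
  fun m => (comp_mpoly [tuple mps_trunc (mdeg m).+1 (hs i) | i < n]
                       (mps_trunc (mdeg m).+1 g))@_m.

Definition mps_var (n : nat) (i : 'I_n) : mps n A :=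
  fun m => (m == U_(i)%MM)%:R.

Definition mps_zero (n : nat) : mps n A := fun _ => 0.

(* The univariate series with coefficient sequence f. *)
Definition mps1 (f : nat -> A) : mps 1 A := fun m => f (mdeg m).

End PowerSeries.

Arguments mps_zero A n : clear implicits.

Definition args1 (T : Type) (x : T) : 'I_1 -> T := fun _ => x.
Definition args2 (T : Type) (x y : T) : 'I_2 -> T :=
  fun i => if i == ord0 then x else y.

Section FormalGroups.
Variables (A : fieldType) (w : A -> rat).

Let X0 : mps 3 A := mps_var A (inord 0).
Let X1 : mps 3 A := mps_var A (inord 1).
Let X2 : mps 3 A := mps_var A (inord 2).

(* One-dimensional commutative formal group over the valuation ring of w. *)
Definition formal_group (F : mps 2 A) : Prop :=
  [/\ forall m, in_O w (F m),
      mps_comp F (args2 (mps_var A ord0) (mps_zero A 1)) =1 mps_var A ord0,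
      mps_comp F (args2 (mps_zero A 1) (mps_var A ord0)) =1 mps_var A ord0,
      mps_comp F (args2 (mps_comp F (args2 X0 X1)) X2)
        =1 mps_comp F (args2 X0 (mps_comp F (args2 X1 X2)))
    & mps_comp F (args2 (mps_var A ord_max) (mps_var A ord0)) =1 F].

Definition is_log (F : mps 2 A) (f : nat -> A) : Prop :=
  [/\ f 0%N = 0, f 1%N = 1
    & mps_comp (mps1 f) (args1 F)
        =1 fun m => mps_comp (mps1 f) (args1 (mps_var A (ord0 : 'I_2))) m
                  + mps_comp (mps1 f) (args1 (mps_var A (ord_max : 'I_2))) m].

(* T * g = g^phi (X^q) *)
Definition T_act (phi : A -> A) (q : nat) (g : nat -> A) : nat -> A :=
  fun n => if (q %| n)%N then phi (g (n %/ q)%N) else 0.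

(* u * g for u = \sum_i u_i T^i and g without constant term: since i < q ^ i,
   the terms with i > n do not contribute to the coefficient of X^n. *)
Definition tw_act (phi : A -> A) (q : nat) (u g : nat -> A) : nat -> A :=
  fun n => \sum_(i < n.+1) u i * iter i (T_act phi q) g n.

Definition is_type (pi : A) (u : nat -> A) : Prop :=
  u 0%N = pi /\ forall i, in_O w (u i).

(* The term u 0 = pi of a type is not a unit, so starting at 0 is harmless. *)
Definition has_height (u : nat -> A) (h : nat) : Prop :=
  unit_O w (u h) /\ forall i, (i < h)%N -> ~~ unit_O w (u i).

Definition honda_of_type (phi : A -> A) (q : nat) (pi : A) (u f : nat -> A) : Prop :=
  forall n, in_O w (tw_act phi q u f n / pi).

(* [a]_F, the unique series without constant term such that f o [a]_F = a f. *)
Definition fg_mult (f : nat -> A) (a : A) : nat -> A :=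
  epsilon (inhabits (fun _ => 0))
    (fun g => g 0%N = 0 /\
       mps_comp (mps1 f) (args1 (mps1 g)) =1 mps1 (fun n => a * f n)).

End FormalGroups.

Section Points.
Variables (A : fieldType) (O : fieldType) (v : O -> rat) (j : A -> O).

Definition mps_psum (n : nat) (g : mps n A) (x : 'I_n -> O) (N : nat) : O :=
  \sum_(m : 'X_{1..n < N}) j (g m) * \prod_(i < n) x i ^+ (m : 'X_{1..n}) i.

(* The value of the series g (with coefficients mapped by j) at x, meaningful
   when the partial sums converge. *)
Definition mps_eval (n : nat) (g : mps n A) (x : 'I_n -> O) : O :=
  epsilon (inhabits 0) (fun l => v_cvg v (mps_psum g x) l).

Definition fg_add (F : mps 2 A) (x y : O) : O := mps_eval F (args2 x y).

Definition fg_scale (f : nat -> A) (a : A) (x : O) : O :=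
  mps_eval (mps1 (fg_mult f a)) (args1 x).

Definition fg_lincomb (F : mps 2 A) (f : nat -> A) (h : nat)
  (a : 'I_h -> A) (z : 'I_h -> O) : O :=
  \big[fg_add F/0]_(i < h) fg_scale f (a i) (z i).

(* F(p_E) inside F(p_O), for a field E embedded in O by e *)
Definition fg_points (E : fieldType) (e : E -> O) (x : O) : Prop :=
  in_p v x /\ exists y, x = e y.

Definition torsion (f : nat -> A) (pi : A) (k : nat) (x : O) : Prop :=
  in_p v x /\ fg_scale f (pi ^+ k) x = 0.

Definition all_torsion (f : nat -> A) (pi : A) (x : O) : Prop :=
  exists k, torsion f pi k x.

(* C +_F [pi]_F(P); the elements of F(p_E) / [pi]_F F(p_E) are the sets
   fg_coset P x with P = F(p_E) and x in P. *)
Definition add_piP (F : mps 2 A) (f : nat -> A) (pi : A) (P C : O -> Prop)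
  (y : O) : Prop :=
  exists x z, [/\ C x, P z & y = fg_add F x (fg_scale f pi z)].

Definition fg_coset (F : mps 2 A) (f : nat -> A) (pi : A) (P : O -> Prop) (x : O) :=
  add_piP F f pi P (fun y => y = x).

(* The map F(p_L)/[pi]F(p_L) -> F(p_M)/[pi]F(p_M) induced by PL `<=` PM sends
   the class x +_F [pi]PL to x +_F [pi]PM = (x +_F [pi]PL) +_F [pi]PM. *)
Definition in_ker_ind (F : mps 2 A) (f : nat -> A) (pi : A) (PL PM : O -> Prop)
  (C : O -> Prop) : Prop :=
  (exists2 x, PL x & forall y, C y <-> fg_coset F f pi PL x y) /\
  (forall y, add_piP F f pi PM C y <-> fg_coset F f pi PM 0 y).

End Points.

Section Independence.
Variables (K0 : fieldType) (K : fieldExtType K0) (O : fieldType).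
Variables (v : O -> rat) (j : K -> O) (F : mps 2 K) (f : nat -> K).
Variable w0 : K0 -> rat.

(* z is a basis of the O_{K0}/pi^s-module W^s_F *)
Definition torsion_basis (pi : K0) (s h : nat) (z : 'I_h -> O) : Prop :=
  [/\ forall i, torsion v j f pi%:A s (z i),
      forall x, torsion v j f pi%:A s x ->
        exists2 a : 'I_h -> K0, forall i, in_O w0 (a i)
          & x = fg_lincomb v j F f (fun i => (a i)%:A) z
    & forall a : 'I_h -> K0, (forall i, in_O w0 (a i)) ->
        fg_lincomb v j F f (fun i => (a i)%:A) z = 0 ->
        forall i, in_O w0 (a i / pi ^+ s)].

(* Linear independence over the residue field k of the classes of the z_i in a
   quotient of a formal module, where zero x says that the class of x vanishes.
   The k-action on classes is c . [x] = [[a]_F x] for any lift a of c. *)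
Definition k_independent (k : finFieldType) (red : K0 -> k)
  (zero : O -> Prop) (h : nat) (z : 'I_h -> O) : Prop :=
  forall (c : 'I_h -> k) (a : 'I_h -> K0),
    (forall i, in_O w0 (a i) /\ red (a i) = c i) ->
    zero (fg_lincomb v j F f (fun i => (a i)%:A) z) ->
    forall i, c i = 0.

End Independence.

(* Main.v *)
Require Import Defs.
From HB Require Import structures.
From mathcomp Require Import all_boot all_order all_algebra all_fingroup all_field.
From mathcomp Require Import zify ring.
From Stdlib Require Import FunctionalExtensionality.

Set Implicit Arguments.
Unset Strict Implicit.
Unset Printing Implicit Defensive.

Import Order.TTheory GRing.Theory Num.Theory.
Local Open Scope ring_scope.

(* If a combination of the zeta_i with coefficients a_i is [pi](z) with z in
   F(p_M), then z is killed by [pi^(s+1)], hence z lies in W^s and is itself a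
   combination of the zeta_i with coefficients b_i; freeness gives
   pi^s | a_i - pi b_i, so pi | a_i.

   For this argument F(p_M) must be a genuine O_{K0}-module.  Series with
   integral coefficients converge on p_M because M, being finite over Q_p, is
   complete; and [a]_F is integral for a in O_{K0} by Honda's theory: f has
   denominators so mild that x = y mod pi implies f(x) = f(y) mod pi, and
   together with psi^phi(X^q) = psi^q mod pi this yields
   u * (f o psi) = (u * f) o psi = 0 mod pi for every integral psi.  The module
   identities hold formally, by injectivity of P |-> f o P, and evaluation at
   points of p_M commutes with substitution. *)

(** * Valuations *)

(** The mildness of the denominators is quantitative. If [q^k] is the largest power of [q] dividing
    [n], then [f n] has denominator at most [pi^k], because Honda's recursion loses one [pi] for
    each division of the index by [q]. In return, [x = y] mod [pi] gives [x^n = y^n] mod [pi^(k+1)]: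
    powers gain one factor more than [f] loses. Both [fg_mult] and [mps_eval] are chosen by
    [epsilon], so nothing is known about them before a solution or a limit has been exhibited.
    Completeness holds for M and not for the ambient [Kalg]; points are therefore elements of [Kalg]
    in the image of M, and partial sums have to be kept there. Two filtrations carry the passage
    from series to values: order in the variables and valuation. At a point whose coordinates have
    valuation at least [c > 0], order [N] becomes valuation at least [c N], so identities are
    checked on polynomials up to order [N] and then [N] grows. Both independence claims come down to
    the same fact: vanishing over M, or membership in the kernel, places the combination itself in
    [[pi]F(p_M)]. *)

Lemma rat_natmul_ge (c d : rat) :
  0 < d -> exists n0, forall n, (n0 <= n)%N -> c <= d *+ n.
Proof.
move=> d0; exists (Num.bound (`|c| / d)) => n bn.
apply: le_trans (ler_norm c) _.
rewrite -[_ *+ n]mulr_natl -ler_pdivrMr //.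
have /archi_boundP/ltW/le_trans-> // : 0 <= `|c| / d.
  by rewrite divr_ge0 // ltW.
by rewrite ler_nat.
Qed.

Section ValuationTheory.
Variables (E : fieldType) (w : E -> rat).
Hypothesis w_val : is_valuation w.

Lemma valM x y : x != 0 -> y != 0 -> w (x * y) = w x + w y.
Proof. by case: w_val => wM _; apply: wM. Qed.

Lemma val1 : w 1 = 0.
Proof.
by apply: (addrI (w 1)); rewrite -valM ?oner_neq0 // mulr1 addr0.
Qed.

Lemma valN1 : w (-1) = 0.
Proof.
have N1_neq0 : -1 != 0 :> E by rewrite oppr_eq0 oner_neq0.
have := valM N1_neq0 N1_neq0; rewrite mulrNN mulr1 val1.
by move/esym/eqP; rewrite -mulr2n mulrn_eq0 /= => /eqP.
Qed.

Lemma valV x : x != 0 -> w x^-1 = - w x.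
Proof.
move=> x0; apply: (addrI (w x)).
by rewrite -valM ?invr_eq0 // divff // val1 subrr.
Qed.

Lemma val_ge0 c : val_ge w c 0. Proof. by rewrite /val_ge eqxx. Qed.

Lemma val_geW c d x : d <= c -> val_ge w c x -> val_ge w d x.
Proof.
by rewrite /val_ge => dc /orP[->//|cx]; rewrite (le_trans dc cx) orbT.
Qed.

Lemma val_geD c x y : val_ge w c x -> val_ge w c y -> val_ge w c (x + y).
Proof.
rewrite /val_ge; have [->|x0] := eqVneq x 0; first by rewrite add0r.
have [->|y0] := eqVneq y 0; first by rewrite addr0 (negPf x0).
have [//|s0] /= := eqVneq (x + y) 0; case: w_val => _ wD cx cy.
by apply: le_trans (wD _ _ x0 y0 s0); rewrite le_min cx cy.
Qed.

Lemma val_geM c d x y :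
  val_ge w c x -> val_ge w d y -> val_ge w (c + d) (x * y).
Proof.
rewrite /val_ge; have [->|x0] := eqVneq x 0; first by rewrite mul0r eqxx.
have [->|y0] := eqVneq y 0; first by rewrite mulr0 eqxx.
by move=> cx dy; rewrite valM // lerD ?orbT.
Qed.

Lemma val_geN c x : val_ge w c (- x) = val_ge w c x.
Proof.
rewrite /val_ge oppr_eq0; have [//|x0] := eqVneq x 0.
by rewrite -mulN1r valM ?oppr_eq0 ?oner_neq0 // valN1 add0r.
Qed.

Lemma val_geB c x y : val_ge w c x -> val_ge w c y -> val_ge w c (x - y).
Proof. by move=> cx cy; rewrite val_geD ?val_geN. Qed.

Lemma val_geBC c x y : val_ge w c (x - y) = val_ge w c (y - x).
Proof. by rewrite -opprB val_geN. Qed.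

Lemma val_ge_trans c x y z :
  val_ge w c (x - y) -> val_ge w c (y - z) -> val_ge w c (x - z).
Proof. by move=> xy yz; rewrite -[x](subrK y) -addrA val_geD. Qed.

Lemma val_ge_sum c (I : Type) (r : seq I) (P : pred I) (G : I -> E) :
  (forall i, P i -> val_ge w c (G i)) -> val_ge w c (\sum_(i <- r | P i) G i).
Proof. 
move=> cG; elim/big_ind: _ => //; first exact: val_ge0.
by move=> x y; apply: val_geD.
Qed.

Lemma val_ge_self x : val_ge w (w x) x.
Proof. by rewrite /val_ge lexx orbT. Qed.

Lemma val_geE c x : x != 0 -> val_ge w c x = (c <= w x).
Proof. by rewrite /val_ge => /negPf ->. Qed.

Lemma val_ge_eq0 x : (forall c, val_ge w c x) -> x = 0.
Proof.
move=> big; apply/eqP; apply: contraT => x0.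
by have := big (w x + 1); rewrite val_geE // gerDl ler10.
Qed.

Lemma val_geX c x n : val_ge w c x -> val_ge w (c *+ n) (x ^+ n).
Proof.
move=> cx; elim: n => [|n IHn]; last by rewrite exprS mulrS val_geM.
by rewrite mulr0n /val_ge expr0 val1 lexx orbT.
Qed.

Lemma val_ge_in_p c x : 0 < c -> val_ge w c x -> in_p w x.
Proof.
by move=> c0; rewrite /val_ge /in_p => /orP[->//|/(lt_le_trans c0) ->]; rewrite orbT.
Qed.

Lemma in_p_val_ge x : in_p w x -> exists2 c, 0 < c & val_ge w c x.
Proof.
rewrite /in_p; have [->|x0 /= wx] := eqVneq x 0.
  by exists 1; rewrite ?ltr01 ?val_ge0.
by exists (w x); rewrite ?val_ge_self.
Qed.

Lemma in_pW x : in_p w x -> in_O w x.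
Proof. by case/in_p_val_ge=> c /ltW c0; apply: val_geW. Qed.

Lemma in_O_subring : subring_closed (in_O w : {pred E}).
Proof.
split=> [|x y|x y]; rewrite /in_O -?topredE /=.
- by rewrite /val_ge val1 lexx orbT.
- exact: val_geB.
- by move=> x0 y0; rewrite -[0]addr0 val_geM.
Qed.

Lemma v_cvg_unique (s : nat -> E) a b : v_cvg w s a -> v_cvg w s b -> a = b.
Proof.
move=> sa sb; apply/eqP; rewrite -subr_eq0; apply/eqP/val_ge_eq0 => c.
have [n1 an] := sa c; have [n2 bn] := sb c.
apply: (@val_ge_trans _ _ (s (maxn n1 n2))).
  by rewrite val_geBC an ?leq_maxl.
by rewrite bn ?leq_maxr.
Qed.

End ValuationTheory.

Lemma is_valuation_comp (A E : fieldType) (j : {rmorphism A -> E}) w :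
  is_valuation w -> is_valuation (w \o j).
Proof.
move=> [wM wD]; split=> x y x0 y0 /=; first by rewrite rmorphM wM ?fmorph_eq0.
by move=> s0; rewrite rmorphD wD -?rmorphD ?fmorph_eq0.
Qed.

Lemma val_ge_comp (A E : fieldType) (j : {rmorphism A -> E}) w c x :
  val_ge (w \o j) c x = val_ge w c (j x).
Proof. by rewrite /val_ge fmorph_eq0. Qed.

Lemma in_p_comp (A E : fieldType) (j : {rmorphism A -> E}) w x :
  in_p (w \o j) x = in_p w (j x).
Proof. by rewrite /in_p fmorph_eq0. Qed.

(** The valuation of [Kalg] is compared with [vp] only off 0; the value at 0 carries no information,
    so completeness is insensitive to it. *)
Lemma v_complete_eq (E : fieldType) (w1 w2 : E -> rat) :
  (forall x, x != 0 -> w1 x = w2 x) -> v_complete w1 -> v_complete w2.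
Proof.
move=> w12 cpl s s_cauchy.
have ge12 c x : val_ge w1 c x = val_ge w2 c x.
  by rewrite /val_ge; case: eqVneq => //= /w12 ->.
have [c|l sl] := cpl s.
  have [n0 sn] := s_cauchy c.
  by exists n0 => m n mn nn; rewrite ge12 sn.
by exists l => c; have [n0 sn] := sl c; exists n0 => n /sn; rewrite ge12.
Qed.

(** * Completeness of finite extensions of a complete valued field *)

Section FiniteExtension.
Variables (A : fieldType) (B : fieldExtType A) (w : B -> rat).
Hypothesis w_val : is_valuation w.
Hypothesis A_complete : v_complete (w \o in_alg B).

Let lincomb (X : seq B) (a : nat -> A) : B := \sum_(i < size X) a i *: X`_i.

(** Continuity of the coordinates on the span of [X], with a uniform loss [C]. Families are indexed
    by [nat] to make induction on [X] painless; entries beyond [size X] are ignored. *)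
Let coord_bound (X : seq B) (C : rat) : Prop :=
  forall a c, val_ge w c (lincomb X a) ->
  forall i, (i < size X)%N -> val_ge (w \o in_alg B) (c - C) (a i).

Let lincombB X a b : lincomb X a - lincomb X b = lincomb X (fun i => a i - b i).
Proof. by rewrite -sumrB; apply: eq_bigr => i _; rewrite scalerBl. Qed.

Let lincomb_small X :
  exists D, forall a c, (forall i, (i < size X)%N ->
    val_ge (w \o in_alg B) c (a i)) -> val_ge w (c + D) (lincomb X a).
Proof.
elim: X => [|x X [D HD]].
  by exists 0 => a c _; rewrite /lincomb big_ord0 val_ge0.
exists (Num.min (w x) D) => a c ac.
rewrite /lincomb big_ord_recl; apply: val_geD => //=.
  rewrite -[_ *: x]mulr_algl; apply: val_geM => //.
    by have := ac 0%N isT; rewrite (val_ge_comp (in_alg B)).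
  by apply: val_geW (val_ge_self w x); rewrite ge_min lexx.
apply: (val_geW (c := c + D)); first by rewrite lerD2l ge_min lexx orbT.
by apply: (HD (fun i => a i.+1)) => i iX; apply: ac.
Qed.

(** The coordinate bound makes every coordinate sequence Cauchy in the complete field [A]; the
    limits recombine by the easy converse estimate [lincomb_small]. *)
Let lincomb_complete X C : coord_bound X C ->
  forall a : nat -> nat -> A, v_cauchy w (fun n => lincomb X (a n)) ->
  exists l, v_cvg w (fun n => lincomb X (a n)) (lincomb X l).
Proof.
move=> XC a a_cauchy.
have ai_cvg i : exists l, (i < size X)%N -> v_cvg (w \o in_alg B) (a^~ i) l.
  case: (ltnP i (size X)) => [iX|]; last by exists 0.
  have [c|l al] := A_complete (s := a^~ i); last by exists l.
  have [n0 Hn] := a_cauchy (c + C); exists n0 => m n mn nn.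
  have := Hn m n mn nn; rewrite lincombB => /XC/(_ i iX).
  by rewrite addrK.
have [l al] := choice (fun i l => (i < size X)%N -> _) ai_cvg.
exists l => c; have [D HD] := lincomb_small X.
(* There are finitely many coordinates, so one rank serves them all; the induction runs over initial
   segments of the coordinates. *)
have [N HN] : exists N, forall n i, (N <= n)%N -> (i < size X)%N ->
    val_ge (w \o in_alg B) (c - D) (a n i - l i).
  elim: (size X) al => [|k IHk] al; first by exists 0%N.
  have [i ik|N HN] := IHk; first by apply: al; rewrite ltnW.
  have [N' HN'] := al k (leqnn _) (c - D); exists (maxn N N') => n i.
  rewrite geq_max => /andP[Nn N'n]; rewrite ltnS leq_eqVlt => /orP[/eqP->|ik].
    exact: HN'.
  exact: HN.
exists N => n Nn; rewrite lincombB -[c](subrK D).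
by apply: HD => i iX; apply: HN.
Qed.

(* A vector outside the span of X is at positive distance from it, because the
   span is complete; this bounds its coordinate. *)
Let free_coord_bound X : free X -> exists C, coord_bound X C.
Proof.
elim: X => [_|x X IHX]; first by exists 0.
rewrite free_cons => /andP[xX /IHX[C XC]] {IHX}.
have [D HD] : exists D, forall a, ~~ val_ge w D (x - lincomb X a).
  apply: NNPP => far.
  have near n : exists a, val_ge w n%:R (x - lincomb X a).
    apply: NNPP => nnear; apply: far; exists n%:R => a.
    by apply/negP => xa; apply: nnear; exists a.
  have [a xa] := choice _ near.
  have large c : exists n0, forall n, (n0 <= n)%N ->
      val_ge w c (x - lincomb X (a n)).
    have [n0 Hn] := rat_natmul_ge c ltr01.
    by exists n0 => n /Hn cn; apply: val_geW (xa n).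
  have [c|l al] := lincomb_complete XC (a := a).
    have [n0 Hn] := large c; exists n0 => m n mn nn.
    by apply: (val_ge_trans w_val (y := x)); rewrite ?Hn // val_geBC // Hn.
  case/negP: xX; suff -> : x = lincomb X l.
    by apply: memv_suml => i _; rewrite memvZ // memv_span // mem_nth.
  apply: (v_cvg_unique w_val) al => c; have [n0 Hn] := large c.
  by exists n0 => n /Hn; rewrite val_geBC.
(* The tail is [y = z - a_0 x] with [z] of valuation at least [c] and [a_0 x] at least
   [c - D + w x], so [e] is the loss in passing from [z] to [y]. *)
pose e := Num.max 0 (D - w x).
exists (Num.max D (e + C)) => a c.
set y := lincomb X (fun i => a i.+1).
have -> : lincomb (x :: X) a = a 0%N *: x + y by rewrite /lincomb big_ord_recl.
move=> cz.
have a0D : val_ge (w \o in_alg B) (c - D) (a 0%N).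
  rewrite val_ge_comp; have [->|a0] := eqVneq (a 0%N) 0.
    by rewrite rmorph0 val_ge0.
  have a0B : in_alg B (a 0%N) != 0 by rewrite fmorph_eq0.
  (* If [a_0] had valuation below [c - D], dividing the vector by [a_0] would produce an element of
     the span of [X] closer to [x] than [D] allows. *)
  rewrite val_geE // leNgt; apply/negP => lt_a0.
  case/negP: (HD (fun i => - (a i.+1 / a 0%N))).
  apply: (val_geW (c := - w (in_alg B (a 0%N)) + c)).
    by rewrite addrC lerBrDr ltW // -ltrBrDl.
  suff -> : x - lincomb X (fun i => - (a i.+1 / a 0%N)) =
      (in_alg B (a 0%N))^-1 * (a 0%N *: x + y).
    by apply: val_geM => //; rewrite -valV // val_ge_self.
  rewrite -fmorphV [in RHS]/= mulr_algl scalerDr scalerA mulVf // scale1r.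
  congr (_ + _); rewrite /y /lincomb -sumrN scaler_sumr; apply: eq_bigr => i _.
  by rewrite scaleNr opprK scalerA mulrC.
have ye : val_ge w (c - e) y.
  have -> : y = (a 0%N *: x + y) - a 0%N *: x by rewrite addrC addKr.
  apply: val_geB => //.
    by apply: val_geW cz; rewrite gerDl oppr_le0 le_max lexx.
  apply: (val_geW (c := c - D + w x)).
    by rewrite -addrA lerD2l lerNl opprD opprK le_max lexx orbT.
  rewrite -[_ *: x]mulr_algl; apply: val_geM (val_ge_self w x) => //.
  by rewrite -(val_ge_comp (in_alg B)).
case=> [_|i iX].
  by apply: val_geW a0D; rewrite lerD2l lerN2 le_max lexx.
apply: (val_geW (c := c - e - C)); last exact: XC ye i iX.
by rewrite -addrA -opprD lerD2l lerN2 le_max lexx orbT.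
Qed.

Lemma finite_extension_complete : v_complete w.
Proof.
move=> s s_cauchy; pose X := vbasis {:B}%VS.
have X_free : free X := basis_free (vbasisP _).
have [C XC] := free_coord_bound X_free.
pose a n i := if insub i is Some k then coord X k (s n) else 0.
have sE n : s n = lincomb X (a n).
  rewrite [LHS](coord_vbasis (memvf _)) /lincomb size_tuple.
  by apply: eq_bigr => i _; rewrite /a valK.
have [|l sl] := lincomb_complete XC (a := a).
  by move=> c; have [n0 Hn] := s_cauchy c; exists n0 => m n; rewrite -!sE; apply: Hn.
by exists (lincomb X l) => c; have [n0 Hn] := sl c; exists n0 => n; rewrite sE; apply: Hn.
Qed.

End FiniteExtension.

(** * Integrality of [a]_F *)

Lemma coef0_expr_small (R : nzRingType) (x : {poly R}) k n :
  x`_0 = 0 -> (n < k)%N -> (x ^+ k)`_n = 0.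
Proof.
move=> x0; elim: k n => // k IHk n nk; rewrite exprS coefM big1 // => -[[|j] jn] _ /=.
  by rewrite x0 mul0r.
by rewrite IHk ?mulr0 //; lia.
Qed.

Lemma poly_comp_sum (R : comNzRingType) (f : nat -> R) n (x : {poly R}) :
  (\poly_(i < n) f i) \Po x = \sum_(i < n) f i *: x ^+ i.
Proof.
rewrite poly_def raddf_sum; apply: eq_bigr => i _ /=.
by rewrite comp_polyZ (rmorphXn (comp_poly _)) /= comp_polyX.
Qed.

(** Powers of [x] beyond [k] start after degree [k]. Any long enough truncation of [f] thus gives
    the same coefficient, and identities of series can be tested on polynomials. *)
Lemma coef_poly_comp (R : comNzRingType) (f : nat -> R) n k (x : {poly R}) :
  x`_0 = 0 -> (k < n)%N ->
  ((\poly_(i < n) f i) \Po x)`_k = ((\poly_(i < k.+1) f i) \Po x)`_k.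
Proof.
move=> x0 kn; rewrite !poly_comp_sum !coef_sum.
rewrite -(big_mkord xpredT (fun i => (f i *: x ^+ i)`_k)).
rewrite (big_cat_nat _ (n := k.+1)) //= big_mkord [X in _ + X]big_nat.
rewrite [X in _ + X]big1 ?addr0 //.
by move=> i /andP[ki _]; rewrite coefZ coef0_expr_small // mulr0.
Qed.

(** Only the linear term of [P] sees the first coefficient at which [x] and [y] differ. This is what
    makes equations [f o g = b] solvable coefficient by coefficient. *)
Lemma coef_comp_sub (R : comNzRingType) (P x y : {poly R}) k :
  x`_0 = 0 -> y`_0 = 0 -> (forall j, (j < k)%N -> x`_j = y`_j) ->
  (P \Po x)`_k - (P \Po y)`_k = P`_1 * (x`_k - y`_k).
Proof.
move=> x0 y0 xy.
have [->|k_gt0] := posnP k.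
  by rewrite x0 y0 subrr mulr0 -!horner_coef0 !horner_comp !horner_coef0 x0 y0 subrr.
(* For [i >= 2], write [x^i - y^i] as [x - y] times a cofactor: the first vanishes below degree [k],
   the second has no constant term. *)
have P2 i : (x ^+ i)`_k - (y ^+ i)`_k = (x`_k - y`_k) *+ (i == 1%N).
  case: i => [|[|i]]; rewrite ?expr0 ?subrr ?expr1 //= mulr0n -coefB subrXX.
  rewrite coefM big1 // => j _; have [jk|kj] := ltnP j k.
    by rewrite coefB xy // subrr mul0r.
  have -> : (k - j = 0)%N by apply/eqP; rewrite subn_eq0.
  rewrite coef_sum big1 ?mulr0 // => -[[|l] li] _ /=.
    by rewrite expr0 mulr1 coef0_expr_small.
  by rewrite coef0M (@coef0_expr_small _ y) // mulr0.
rewrite !coef_comp_poly -sumrB.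
under eq_bigr => i _ do rewrite -mulrBr P2 mulrnAr mulrb.
rewrite -big_mkcond /=; have [P1|P1] := ltnP 1 (size P).
  by rewrite (big_pred1 (Ordinal P1)).
rewrite [P`_1]nth_default // mul0r big1 // => i /eqP i1.
by have := ltn_ord i; rewrite i1 ltnNge P1.
Qed.

(** * Congruences modulo powers of pi and Honda's integrality argument *)

Section Honda.
Variables (K : fieldType) (S : subringClosed K) (pi : K).
Variables (phi : {rmorphism K -> K}) (p r : nat).
Hypotheses (p_prime : prime p) (r_gt0 : (0 < r)%N).
Hypotheses (pi_neq0 : pi != 0) (S_pi : pi \in S) (p_pi : p%:R / pi \in S).
Hypotheses (phi_pi : phi pi = pi) (phiS : forall x, x \in S -> phi x \in S).
Let q := (p ^ r)%N.
Hypothesis frob : forall x, x \in S -> (phi x - x ^+ q) / pi \in S.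

(* x lies in pi^k O[X], where O = S is the ring of integers *)
Definition pint k (x : {poly K}) : Prop := forall i, x`_i / pi ^+ k \in S.

Lemma q_gt1 : (1 < q)%N.
Proof. by rewrite /q -(expn0 p) ltn_exp2l ?prime_gt1. Qed.

Let q_gt0 : (0 < q)%N := ltnW q_gt1.

Lemma pint0P x : pint 0 x <-> x \is a polyOver S.
Proof.
split=> [Sx|/polyOverP Sx i]; last by rewrite expr0 divr1.
by apply/polyOverP => i; have := Sx i; rewrite expr0 divr1.
Qed.

Lemma pint_zero k : pint k 0.
Proof. by move=> i; rewrite coef0 mul0r rpred0. Qed.

Lemma pintD k x y : pint k x -> pint k y -> pint k (x + y).
Proof. by move=> Sx Sy i; rewrite coefD mulrDl rpredD. Qed.

Lemma pintN k x : pint k x -> pint k (- x).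
Proof. by move=> Sx i; rewrite coefN mulNr rpredN. Qed.

Lemma pint_trans k x y z : pint k (x - y) -> pint k (y - z) -> pint k (x - z).
Proof. by move=> xy yz; rewrite -[x](subrK y) -addrA; apply: pintD. Qed.

Lemma pint_sum k (I : Type) (s : seq I) (P : pred I) (G : I -> {poly K}) :
  (forall i, P i -> pint k (G i)) -> pint k (\sum_(i <- s | P i) G i).
Proof.
move=> kG; elim/big_ind: _ => //; first exact: pint_zero.
by move=> x y; apply: pintD.
Qed.

Lemma pintM k l x y : pint k x -> pint l y -> pint (k + l) (x * y).
Proof.
move=> Sx Sy i; rewrite coefM mulr_suml rpred_sum // => j _.
by rewrite exprD invfM mulrACA rpredM.
Qed.

Lemma pintMr k x y : pint k x -> pint 0 y -> pint k (x * y).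
Proof. by rewrite -{2}[k]addn0; apply: pintM. Qed.

Lemma pintZ k l c x : c / pi ^+ k \in S -> pint l x -> pint (k + l) (c *: x).
Proof.
move=> Sc Sx i.
by rewrite coefZ exprD invfM mulrACA rpredM.
Qed.

Lemma pintX x n : pint 0 x -> pint 0 (x ^+ n).
Proof. by move=> /pint0P Sx; apply/pint0P; rewrite rpredX. Qed.

Lemma pintS k x : pint k.+1 x -> pint k x.
Proof.
move=> Sx i; have := rpredM (Sx i) S_pi.
by rewrite exprSr invfM mulrA divfK.
Qed.

Lemma pint_subX k x y n : pint 0 x -> pint 0 y ->
  pint k (x - y) -> pint k (x ^+ n - y ^+ n).
Proof.
move=> Sx Sy xy; rewrite subrXX; apply: pintMr => //.
apply: pint_sum => i _.
by rewrite -[0%N]addn0; apply: pintM; apply: pintX.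
Qed.

Lemma p_pint k x : pint k x -> pint k.+1 (x *+ p).
Proof. by move=> Sx; rewrite -scaler_nat -add1n; apply: pintZ; rewrite ?expr1. Qed.

(** The cofactor of [x - y] in [x^q - y^q] is congruent to [q y^(q-1)] mod [pi], and [p], hence
    [pi], divides [q] because [r > 0]. This is the extra factor [pi]. *)
Lemma pint_subXq k x y : pint 0 x -> pint 0 y ->
  pint k.+1 (x - y) -> pint k.+2 (x ^+ q - y ^+ q).
Proof.
move=> Sx Sy xy; rewrite subrXX -addn1; apply: pintM => //.
have xy1 : pint 1 (x - y) by elim: k xy => // k IHk /pintS.
rewrite -[\sum_(_ < _) _](subrK (y ^+ q.-1 *+ q)); apply: pintD; last first.
  by rewrite /q -(prednK r_gt0) expnS mulnC mulrnA; apply/p_pint/pint0P;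
     rewrite rpredMn // rpredX //; apply/pint0P.
rewrite -[in X in _ - _ *+ X](card_ord q) -sumr_const -sumrB.
apply: pint_sum => i _.
have -> : y ^+ q.-1 = y ^+ (q.-1 - i) * y ^+ i.
  by rewrite -exprD subnK // -ltnS prednK.
by rewrite -subn1 -subnDA add1n -mulrBl; apply: pintMr;
   [apply: pint_subX | apply: pintX].
Qed.

Lemma pint_subXqn k x y n : pint 0 x -> pint 0 y ->
  pint 1 (x - y) -> (q ^ k %| n)%N -> pint k.+1 (x ^+ n - y ^+ n).
Proof.
move=> Sx Sy xy /dvdnP[d ->]; rewrite mulnC !exprM.
apply: pint_subX; try exact: pintX.
elim: k => [|k IHk]; first by rewrite !expr1.
by rewrite expnSr !exprM; apply: pint_subXq => //; apply: pintX.
Qed.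

Lemma pint_exprDp x y : pint 0 x -> pint 0 y ->
  pint 1 ((x + y) ^+ p - (x ^+ p + y ^+ p)).
Proof.
move=> Sx Sy; have p_gt0 := prime_gt0 p_prime.
rewrite exprDn (bigD1 ord0) // (bigD1 ord_max) /=; last first.
  by rewrite -(inj_eq val_inj) /= -lt0n.
rewrite subn0 subnn bin0 binn !mulr1n !expr0 mulr1 mul1r addrA.
rewrite [X in pint _ (X - _)]addrC addrK.
apply: pint_sum => i /andP[i0 ip].
have /dvdnP[d ->] : (p %| 'C(p, i))%N.
  apply: prime_dvd_bin => //; rewrite lt0n [(_ != _)%N]i0 /=.
  by rewrite ltn_neqAle -ltnS ltn_ord andbT; apply: contra ip => /eqP ip;
     rewrite -(inj_eq val_inj) /= ip.
rewrite mulrnA; apply/p_pint/pint0P.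
by rewrite rpredMn // rpredM // rpredX //; apply/pint0P.
Qed.

Lemma pint_exprDpk x y k : pint 0 x -> pint 0 y ->
  pint 1 ((x + y) ^+ (p ^ k) - (x ^+ (p ^ k) + y ^+ (p ^ k))).
Proof.
move=> Sx Sy; elim: k => [|k IHk]; first by rewrite !expr1 subrr; apply: pint_zero.
rewrite expnSr !exprM; apply: pint_trans (pint_exprDp _ _); try exact: pintX.
by apply: pint_subX => //; [apply/pintX/pintD | apply: pintD; apply: pintX].
Qed.

(** The operator [T] on polynomials; [coef_iter_Tp] identifies it with [T_act] on coefficient
    sequences. Working with polynomials gives access to composition. *)
Definition Tp (P : {poly K}) : {poly K} := map_poly phi P \Po 'X^q.

Lemma Tp_int P : pint 0 P -> pint 0 (Tp P).
Proof.
move=> /pint0P/polyOverP SP; apply/pint0P; apply: polyOver_comp.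
  by apply/polyOverP => i; rewrite coef_map phiS.
by rewrite rpredX // polyOverX.
Qed.

Lemma Tp_frobenius P : pint 0 P -> pint 1 (Tp P - P ^+ q).
Proof.
(* Additivity of the [q]-th power mod [pi] needs integral summands, so integrality is carried along
   the induction over the monomials of [P]. *)
move=> SP; suff []: pint 0 P /\ pint 1 (Tp P - P ^+ q) by [].
rewrite -[in X in _ /\ X](coefK P) -[in X in X /\ _](coefK P) poly_def.
elim/big_ind: _ => [||i _].
- split; first exact: pint_zero.
  rewrite /Tp rmorph0 comp_poly0 expr0n (gtn_eqF q_gt0) subrr.
  exact: pint_zero.
- move=> x y [Sx Tx] [Sy Ty]; split; first exact: pintD.
  have -> : Tp (x + y) = Tp x + Tp y by rewrite /Tp rmorphD comp_polyD.
  apply: (@pint_trans _ _ (x ^+ q + y ^+ q)).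
    by rewrite opprD addrACA; apply: pintD.
  by rewrite -opprB; apply/pintN/pint_exprDpk.
have SPi : P`_i \in S by have /pint0P/polyOverP := SP.
split; first by apply/pint0P; rewrite polyOverZ // rpredX // polyOverX.
rewrite /Tp linearZ /= map_polyXn comp_polyZ (rmorphXn (comp_poly _)) /=.
rewrite comp_polyX exprZn -!exprM mulnC.
rewrite -scalerBl -[1%N]addn0; apply: pintZ; rewrite ?expr1 ?frob //.
by apply/pint0P; rewrite rpredX // polyOverX.
Qed.

Lemma iter_Tp_int i P : pint 0 P -> pint 0 (iter i Tp P).
Proof. by move=> SP; elim: i => //= i; apply: Tp_int. Qed.

Lemma iter_Tp_frobenius i P :
  pint 0 P -> pint 1 (iter i Tp P - P ^+ (q ^ i)).
Proof.
move=> SP; elim: i => [|i IHi]; first by rewrite expr1 subrr; apply: pint_zero.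
rewrite iterS expnSr exprM; apply: pint_trans (Tp_frobenius (iter_Tp_int i SP)) _.
by apply: pint_subX => //; [apply: iter_Tp_int | apply: pintX].
Qed.

Lemma Tp_comp P Q : Tp (P \Po Q) = map_poly phi P \Po Tp Q.
Proof. by rewrite /Tp map_comp_poly comp_polyA. Qed.

Lemma iter_Tp_comp i P Q :
  iter i Tp (P \Po Q) = iter i (map_poly phi) P \Po iter i Tp Q.
Proof. by elim: i => //= i ->; rewrite Tp_comp. Qed.

Lemma iter_TpE i P : iter i Tp P = iter i (map_poly phi) P \Po 'X^(q ^ i).
Proof.
rewrite -[P in LHS]comp_polyXr iter_Tp_comp; congr (_ \Po _).
elim: i => [|i IHi]; first by rewrite expr1.
rewrite iterS IHi /Tp map_polyXn (rmorphXn (comp_poly _)) /= comp_polyX.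
by rewrite -exprM mulnC expnSr mulnC.
Qed.

Lemma iter_T_act i (g : nat -> K) n : iter i (T_act phi q) g n =
  if (q ^ i %| n)%N then iter i phi (g (n %/ q ^ i)%N) else 0.
Proof.
elim: i n => [|i IHi] n; first by rewrite expn0 dvd1n divn1.
rewrite iterS /T_act; case: ifP => [/dvdnP[d ->]|qn].
  rewrite mulnK // IHi expnSr dvdn_pmul2r // divnMr //.
  by case: ifP; rewrite ?rmorph0.
rewrite ifF //; apply/negP => /(dvdn_trans _) qin.
by rewrite qin // expnS dvdn_mulr in qn.
Qed.

Lemma coef_iter_Tp i (P : {poly K}) n :
  (iter i Tp P)`_n = iter i (T_act phi q) (fun k => P`_k) n.
Proof.
rewrite iter_T_act iter_TpE coef_comp_poly_Xn; last by rewrite expn_gt0 q_gt0.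
case: ifP => // _; elim: i (n %/ _)%N => //= i IHi k.
by rewrite coef_map IHi.
Qed.

(** The denominator of [g n] is at most [pi^k], with [k] the exponent of [q] in [n]. The condition
    is empty at [n = 0], which every power of [q] divides. *)
Definition honda_den (g : nat -> K) : Prop :=
  forall n k, ~~ (q ^ k.+1 %| n)%N -> pi ^+ k * g n \in S.

Lemma iter_phiS i x : x \in S -> iter i phi x \in S.
Proof. by move=> Sx; elim: i => //= i; apply: phiS. Qed.

Lemma iter_phiM i k x : iter i phi (pi ^+ k * x) = pi ^+ k * iter i phi x.
Proof. by elim: i => //= i ->; rewrite rmorphM rmorphXn phi_pi. Qed.

(** Term by term: with [q^k] the exact power of [q] in [n], the denominator [pi^k] is absorbed by
    [x^n - y^n = 0] mod [pi^(k+1)], leaving one [pi]. The constant terms cancel. *)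
Lemma honda_den_comp (P x y : {poly K}) : honda_den (fun i => P`_i) ->
  pint 0 x -> pint 0 y -> pint 1 (x - y) -> pint 1 ((P \Po x) - (P \Po y)).
Proof.
move=> denP Sx Sy xy; rewrite !comp_polyE -sumrB; apply: pint_sum => n _.
rewrite -scalerBr; case: (posnP n) => [->|n_gt0].
  by rewrite !expr0 subrr scaler0; apply: pint_zero.
have [k kn qk] : exists2 k, ~~ (q ^ k.+1 %| n)%N & (q ^ k %| n)%N.
  have ex_k : exists k, ~~ (q ^ k.+1 %| n)%N.
    exists n; apply/negP => /(dvdn_leq n_gt0); apply/negP; rewrite -ltnNge.
    by rewrite (leq_trans (ltn_expl n q_gt1)) // leq_pexp2l.
  case: (ex_minnP ex_k) => -[|k] kn kmin; first by exists 0%N; rewrite ?expn0 ?dvd1n.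
  by exists k.+1 => //; apply: contraT => /kmin; rewrite ltnn.
move=> i; have := pint_subXqn Sx Sy xy qk i.
rewrite coefZ expr1 => /(rpredM (denP n k kn)); rewrite exprS.
have -> // : forall t A B : K, t != 0 -> t * A * (B / (pi * t)) = A * B / pi;
  last by rewrite expf_neq0.
by move=> t A B t0; field; rewrite t0 pi_neq0.
Qed.

Variables (u f : nat -> K).
Hypotheses (u0 : u 0%N = pi) (uS : forall i, u i \in S) (f0 : f 0%N = 0).
Hypothesis f_honda : forall n, tw_act phi q u f n / pi \in S.

(** The coefficient of [X^n] in [u * f] expresses [pi f_n] through the conjugates of [f_(n/q^i)],
    [i >= 1], up to a multiple of [pi]; the index [n/q^i] has lost [i] factors [q], so strong
    induction applies. *)
Lemma log_honda_den : honda_den f.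
Proof.
move=> n; have [k] := ubnP n; elim: k n => // k IHk n; rewrite ltnS => nk s qn.
have n_gt0 : (0 < n)%N by case: (n) qn; rewrite ?dvdn0.
have := f_honda n; rewrite /tw_act big_ord_recl u0 /= mulrDl mulrAC divff // mul1r.
set X := \sum_(_ < _) _; move=> Sf.
have -> : pi ^+ s * f n = pi ^+ s * (f n + X / pi) - pi ^+ s * X / pi.
  by rewrite mulrDr mulrA addrK.
apply: rpredB; first by rewrite rpredM // rpredX.
rewrite mulr_sumr mulr_suml rpred_sum // => i _; rewrite -iterS iter_T_act.
rewrite /bump /= add1n; case: ifP => qin; last by rewrite !mulr0 mul0r rpred0.
have is_ : (i < s)%N.
  rewrite ltnNge; apply: contra qn => si; apply: dvdn_trans qin.
  by rewrite dvdn_exp2l.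
have : pi ^+ (s - i.+1) * f (n %/ q ^ i.+1)%N \in S.
  apply: IHk.
    apply: leq_trans nk; apply: ltn_Pdiv => //.
    by rewrite -(expn0 q) ltn_exp2l ?q_gt1.
  apply: contra qn => /dvdnP[d]; move/(congr1 (muln^~ (q ^ i.+1)%N)).
  rewrite divnK // => ->; rewrite -mulnA -expnD addSn subnK //.
  by rewrite dvdn_mull.
move/(iter_phiS i.+1); rewrite iter_phiM => Sphi.
(* Of the [s] factors [pi], one pays for the division by [pi] and [s - (i+1)] clear the denominator
   at the smaller index; the remaining [i] are integral. *)
have -> : s = (i + (s - i.+1)).+1 by rewrite -addSn subnKC.
rewrite exprSr exprD.
have -> : forall a b c d : K, a * b * pi * (c * d) / pi = a * c * (b * d).
  by move=> a b c d; rewrite mulrAC mulfK // mulrACA.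
by rewrite rpredM // rpredM // rpredX.
Qed.

Lemma iter_map_honda_den i (P : {poly K}) : honda_den (fun k => P`_k) ->
  honda_den (fun k => (iter i (map_poly phi) P)`_k).
Proof.
move=> denP n k kn; elim: i => [|i IHi]; first exact: denP.
by rewrite iterS coef_map -phi_pi -rmorphXn -rmorphM phiS // phi_pi.
Qed.

(** With [P] truncating [f], [T^i (P o psi)] is the [phi^i]-conjugate of [P] taken at [T^i psi],
    whereas [(T^i P) o psi] is the same conjugate at [psi^(q^i)]. The two arguments agree mod [pi],
    so [honda_den_comp] compares the results. *)
Lemma tw_act_comp_log n (psi : {poly K}) : psi`_0 = 0 -> pint 0 psi ->
  tw_act phi q u (fun k => ((\poly_(i < n.+1) f i) \Po psi)`_k) n / pi \in S.
Proof.
move=> psi0 Spsi; set P := \poly_(i < n.+1) f i.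
have denP : honda_den (fun k => P`_k).
  move=> k s /log_honda_den; rewrite coef_poly.
  by case: ifP; rewrite // mulr0 rpred0.
pose H := \sum_(i < n.+1) u i *: iter i Tp P.
pose H1 := \sum_(i < n.+1) u i *: iter i Tp (P \Po psi).
have -> : tw_act phi q u (fun k => (P \Po psi)`_k) n = H1`_n.
  rewrite coef_sum; apply: eq_bigr => i _; rewrite coefZ.
  by rewrite coef_iter_Tp.
have HH1 : pint 1 (H1 - (H \Po psi)).
  have -> : H \Po psi = \sum_(i < n.+1) u i *: (iter i Tp P \Po psi).
    by rewrite raddf_sum; apply: eq_bigr => i _; rewrite /= comp_polyZ.
  rewrite -sumrB; apply: pint_sum => i _; rewrite -scalerBr -[1%N]add0n.
  apply: pintZ; first by rewrite expr0 divr1.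
  rewrite iter_Tp_comp [iter i Tp P]iter_TpE -comp_polyA.
  rewrite (rmorphXn (comp_poly _)) /= comp_polyX.
  apply: honda_den_comp; first exact: iter_map_honda_den.
  - exact: iter_Tp_int.
  - exact: pintX.
  - exact: iter_Tp_frobenius.
rewrite -[H1](subrK (H \Po psi)) coefD mulrDl rpredD //.
rewrite coef_comp_poly mulr_suml rpred_sum // => k _.
(* Above degree [n] the truncation may have spoiled the coefficients of [H], but [psi^k] does not
   reach degree [n] there. *)
have [nk|kn] := ltnP n k; first by rewrite (coef0_expr_small psi0) // mulr0 mul0r rpred0.
rewrite mulrAC rpredM //; last by have /pint0P/polyOverP := pintX k Spsi.
suff -> : H`_k = tw_act phi q u f k by [].
rewrite coef_sum /tw_act.
have iterP i : (iter i Tp P)`_k = iter i (T_act phi q) f k.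
  rewrite coef_iter_Tp !iter_T_act; case: ifP => // _.
  by rewrite coef_poly ltnS (leq_trans (leq_div _ _) kn).
(* [H] sums to [n] and [tw_act] only to [k]; the surplus terms vanish since [q^i > k] cannot divide
   a positive [k], and [f 0 = 0] settles [k = 0]. *)
rewrite -(big_mkord xpredT (fun i => (u i *: iter i Tp P)`_k)).
rewrite (big_cat_nat _ (n := k.+1)) //= big_mkord [X in _ + X]big_nat.
rewrite [X in _ + X]big1 ?addr0.
  by apply: eq_bigr => i _; rewrite coefZ iterP.
move=> i /andP[ki _]; rewrite coefZ iterP iter_T_act.
case: (posnP k) => [->|k_gt0].
  have phi0 : iter i phi 0 = 0 by elim: (i) => //= j ->; rewrite rmorph0.
  by rewrite div0n f0 phi0 if_same mulr0.
rewrite ifN ?mulr0 //; apply/negP => /(dvdn_leq k_gt0); apply/negP.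
by rewrite -ltnNge (ltn_trans ki) // ltn_expl // q_gt1.
Qed.

(* Equality f o g = a f modulo X^(n+1) determines g_n as a coefficient of
   a f - f o (g mod X^n), on which u acts as multiplication by pi. *)
Lemma honda_mult_integral (a : K) (g : nat -> K) :
  a \in S -> phi a = a -> f 1%N = 1 -> g 0%N = 0 ->
  (forall n, ((\poly_(i < n.+1) f i) \Po (\poly_(i < n.+1) g i))`_n = a * f n) ->
  forall n, g n \in S.
Proof.
move=> Sa phi_a f1 g0 fg n; have [k] := ubnP n.
elim: k n => // k IHk n; rewrite ltnS => nk.
have [->|n_gt0] := posnP n; first by rewrite g0 rpred0.
set P := \poly_(i < n.+1) f i; pose psi := \poly_(i < n) g i.
have psi0 : psi`_0 = 0 by rewrite coef_poly g0 if_same.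
have Spsi : pint 0 psi.
  apply/pint0P/polyOverP => i; rewrite coef_poly.
  case: ifP => [i_n|]; last by rewrite rpred0.
  by apply: IHk; apply: leq_trans nk.
(* Dropping [g_n X^n] from the argument leaves the coefficients below degree [n] alone and lowers
   that of degree [n] by [f_1 g_n = g_n]. *)
have psiE k' : (k' <= n)%N -> (P \Po psi)`_k' = a * f k' - (if k' == n then g n else 0).
  move=> kn; rewrite (coef_poly_comp _ psi0) // -(fg k').
  set G := \poly_(i < k'.+1) g i; set Pk := \poly_(i < k'.+1) f i.
  have G0 : G`_0 = 0 by rewrite coef_poly g0.
  rewrite -[LHS](subKr ((Pk \Po G)`_k')) coef_comp_sub //.
    congr (_ - _); rewrite !coef_poly ltnSn; have [->|k'n] := eqVneq k' n.
      by rewrite ltnn subr0 f1 ltnS n_gt0 mul1r.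
    have -> : (k' < n)%N by rewrite ltn_neqAle k'n.
    by rewrite subrr mulr0.
  by move=> j jk; rewrite !coef_poly (ltn_trans jk) // (leq_trans jk kn).
have := tw_act_comp_log n psi0 Spsi; rewrite -/P => Stw.
have Saf : a * tw_act phi q u f n / pi \in S by rewrite -mulrA rpredM.
have := rpredB Saf Stw; rewrite -mulrBl.
suff -> : a * tw_act phi q u f n - tw_act phi q u (fun k => (P \Po psi)`_k) n
   = g n * pi by rewrite mulfK.
rewrite /tw_act mulr_sumr -sumrB big_ord_recl big1 ?addr0 => [|i _].
  by rewrite u0 /= psiE // eqxx mulrBr opprB mulrCA addrC subrK mulrC.
(* The terms with [T^i], [i >= 1], read only indices [n/q^i < n], where the composite equals [a f];
   they cancel because [phi] fixes [a]. *)
rewrite mulrCA -mulrBr !iter_T_act lift0.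
case: ifP => [qn|]; last by rewrite mulr0 subrr mulr0.
rewrite psiE ?leq_div // ltn_eqF ?subr0.
  have -> : iter i.+1 phi (a * f (n %/ q ^ i.+1)%N) =
      a * iter i.+1 phi (f (n %/ q ^ i.+1)%N).
    by elim: i.+1 (f _) => //= j IHj x; rewrite IHj rmorphM phi_a.
  by rewrite subrr mulr0.
by apply: ltn_Pdiv => //; rewrite -(expn0 q) ltn_exp2l ?q_gt1.
Qed.

End Honda.

(** Successive approximation: [G n] solves the equation below degree [n], and since [f 1 = 1] the
    defect in degree [n] is itself the coefficient to add. With [b = a f] this is the existence of
    [[a]_F]. *)
Lemma comp_solve (R : comNzRingType) (f b : nat -> R) :
  f 0%N = 0 -> f 1%N = 1 -> b 0%N = 0 -> exists2 g : nat -> R, g 0%N = 0 &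
  forall n, ((\poly_(i < n.+1) f i) \Po (\poly_(i < n.+1) g i))`_n = b n.
Proof.
move=> f0 f1 b0.
pose G := fix G n : {poly R} := if n is n'.+1 then
  G n' + (b n' - ((\poly_(i < n) f i) \Po G n')`_n') *: 'X^n' else 0.
have G_coef n i : (G n)`_i = if (i < n)%N then (G i.+1)`_i else 0.
  elim: n => [|n IHn]; first by rewrite coef0.
  have [->|ni] := eqVneq i n; first by rewrite ltnSn.
  rewrite [G n.+1]/= coefD coefZ coefXn (negPf ni) mulr0 addr0 IHn.
  by rewrite ltnS [(i <= n)%N]leq_eqVlt (negPf ni).
have poly_f0 : \poly_(i < 1) f i = 0 by rewrite poly_def big_ord1 f0 scale0r.
have G1 : G 1%N = 0 by rewrite /= poly_f0 comp_poly0 coef0 b0 subr0 scale0r addr0.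
exists (fun n => (G n.+1)`_n) => [|n]; first by rewrite G1 coef0.
have -> : \poly_(i < n.+1) (G i.+1)`_i = G n.+1.
  by apply/polyP => i; rewrite coef_poly [RHS]G_coef.
case: n => [|n]; first by rewrite poly_f0 comp_poly0 coef0 b0.
have G0 k : (G k)`_0 = 0 by rewrite G_coef G1 coef0 if_same.
set P := \poly_(i < n.+2) f i.
have Gn : (G n.+1)`_n.+1 = 0 by rewrite G_coef ltnn.
have GSn : (G n.+2)`_n.+1 = b n.+1 - (P \Po G n.+1)`_n.+1.
  by rewrite [G n.+2]/= coefD Gn coefZ coefXn eqxx mulr1 add0r.
have := @coef_comp_sub R P (G n.+2) (G n.+1) n.+1 (G0 _) (G0 _).
rewrite GSn Gn subr0 coef_poly f1 mul1r => GG.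
apply: (addIr (- (P \Po G n.+1)`_n.+1)); apply: GG => j jn.
by rewrite [LHS]G_coef [RHS]G_coef jn (ltn_trans jn).
Qed.

(** * Substitution of power series *)

Section MmapCongruence.
Variables (A R : comNzRingType) (D I : R -> Prop).
Hypotheses (D0 : D 0) (D1 : D 1).
Hypotheses (DD : forall x y, D x -> D y -> D (x + y)).
Hypotheses (DM : forall x y, D x -> D y -> D (x * y)).
Hypotheses (I0 : I 0) (ID : forall x y, I x -> I y -> I (x + y)).
Hypothesis (DI : forall x y, D x -> I y -> I (x * y)).

Lemma mmap_stable (j : A -> R) n (P : {mpoly A[n]}) (x : 'I_n -> R) :
  (forall m, D (j P@_m)) -> (forall i, D (x i)) -> D (mmap j x P).
Proof.
move=> DP Dx; rewrite /mmap; elim/big_ind: _ => // m _; apply: DM => //.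
rewrite /mmap1; elim/big_ind: _ => // i _.
by elim: (m i) => [|k IHk]; rewrite ?expr0 // exprS; apply: DM.
Qed.

(** [D] acts as a subring and [I] as an ideal over it. The two uses are order at least [N] for
    polynomials, with [D] everything, and valuation at least a bound, with [D] the valuation
    ring. *)
Lemma mmap_cong (j : A -> R) n (P : {mpoly A[n]}) (x y : 'I_n -> R) :
  (forall m, D (j P@_m)) -> (forall i, D (x i)) -> (forall i, D (y i)) ->
  (forall i, I (x i - y i)) -> I (mmap j x P - mmap j y P).
Proof.
move=> DP Dx Dy xy; rewrite /mmap -sumrB; elim/big_ind: _ => // m _.
rewrite -mulrBr; apply: DI => //.
pose Q (a b : R) := [/\ D a, D b & I (a - b)].
have QM a b a' b' : Q a b -> Q a' b' -> Q (a * a') (b * b').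
  move=> [Da Db Iab] [Da' Db' Iab']; split; try exact: DM.
  have -> : a * a' - b * b' = a * (a' - b') + b' * (a - b) by ring.
  by apply: ID; apply: DI.
have Q1 : Q 1 1 by split; rewrite ?subrr.
have [] // : Q (mmap1 x m) (mmap1 y m).
rewrite /mmap1; elim/big_ind2: _ => // [a b a' b'|i _]; first exact: QM.
elim: (m i) => [|k IHk]; rewrite ?expr0 // !exprS; apply: QM => //.
Qed.

End MmapCongruence.

Lemma rmorph_mmap n (A R R' : comNzRingType) (j : A -> R) (x : 'I_n -> R)
  (g : {rmorphism R -> R'}) (P : {mpoly A[n]}) :
  g (mmap j x P) = mmap (g \o j) (g \o x) P.
Proof.
rewrite /mmap rmorph_sum; apply: eq_bigr => m _; rewrite rmorphM; congr (_ * _).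
by rewrite /mmap1 rmorph_prod; apply: eq_bigr => i _; rewrite rmorphXn.
Qed.

Section OrderFiltration.
Variables (A : fieldType).
Implicit Types (n k : nat).

Definition mord_ge n N (P : {mpoly A[n]}) : Prop :=
  forall m, (mdeg m < N)%N -> P@_m = 0.

Lemma mord_ge0 n N : mord_ge N (0 : {mpoly A[n]}).
Proof. by move=> m _; rewrite mcoeff0. Qed.

Lemma mord_geD n N (P Q : {mpoly A[n]}) : mord_ge N P -> mord_ge N Q -> mord_ge N (P + Q).
Proof. by move=> NP NQ m mN; rewrite mcoeffD NP // NQ // addr0. Qed.

Lemma mord_geN n N (P : {mpoly A[n]}) : mord_ge N P -> mord_ge N (- P).
Proof. by move=> NP m mN; rewrite mcoeffN NP // oppr0. Qed.

Lemma mord_ge_trans n N (P Q R : {mpoly A[n]}) :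
  mord_ge N (P - Q) -> mord_ge N (Q - R) -> mord_ge N (P - R).
Proof. by move=> PQ QR; rewrite -[P](subrK Q) -addrA; apply: mord_geD. Qed.

Lemma mord_geM n N k (P Q : {mpoly A[n]}) :
  mord_ge N P -> mord_ge k Q -> mord_ge (N + k) (P * Q).
Proof.
move=> NP kQ m mNk; rewrite mcoeffM big1 // => -[m1 m2] /= /eqP mE.
have {}mE := congr1 mdeg mE; rewrite mdegD in mE.
have [m1N|Nm1] := ltnP (mdeg m1) N; first by rewrite NP // mul0r.
rewrite [X in _ * X]kQ ?mulr0 //; lia.
Qed.

Lemma mord_ge_mulr n N (P Q : {mpoly A[n]}) : mord_ge N P -> mord_ge N (P * Q).
Proof. by move=> NP; rewrite -[N]addn0; apply: mord_geM. Qed.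

Lemma mord_ge_mull n N (P Q : {mpoly A[n]}) : mord_ge N Q -> mord_ge N (P * Q).
Proof. by rewrite mulrC; apply: mord_ge_mulr. Qed.

Lemma mord_ge_exp n (P : {mpoly A[n]}) k : mord_ge 1 P -> mord_ge k (P ^+ k).
Proof.
by move=> P1; elim: k => // k IHk; rewrite exprS -add1n; apply: mord_geM.
Qed.

Definition mcomp n k (h : 'I_n -> {mpoly A[k]}) (P : {mpoly A[n]}) :=
  mmap (@mpolyC k A) h P.

Lemma mcomp_cong n k N (h h' : 'I_n -> {mpoly A[k]}) P :
  (forall i, mord_ge N (h i - h' i)) -> mord_ge N (mcomp h P - mcomp h' P).
Proof.
move=> hh; apply: (@mmap_cong _ _ (fun _ => True) (@mord_ge k N)) => //.
- exact: mord_ge0.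
- by move=> x y; apply: mord_geD.
- by move=> x y _; apply: mord_ge_mull.
Qed.

Lemma mord_ge_mcomp n k N (h : 'I_n -> {mpoly A[k]}) P :
  (forall i, mord_ge 1 (h i)) -> mord_ge N P -> mord_ge N (mcomp h P).
Proof.
move=> h1 NP; rewrite /mcomp /mmap; elim/big_ind: _ => [||m _]; first exact: mord_ge0.
  by move=> x y; apply: mord_geD.
have [mN|Nm] := ltnP (mdeg m) N; first by rewrite NP // mpolyC0 mul0r; apply: mord_ge0.
apply: mord_ge_mull => m' m'N.
suff hm : mord_ge (mdeg m) (mmap1 h m) by rewrite hm // (leq_trans m'N Nm).
rewrite mdegE /mmap1; elim/big_ind2: _ => // [x a y b|i _]; first exact: mord_geM.
exact: mord_ge_exp.
Qed.

Lemma mcompB n k (h : 'I_n -> {mpoly A[k]}) P Q :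
  mcomp h (P - Q) = mcomp h P - mcomp h Q.
Proof. exact: mmapB. Qed.

Lemma mcompA n k l (h : 'I_n -> {mpoly A[k]}) (h' : 'I_k -> {mpoly A[l]}) P :
  mcomp h' (mcomp h P) = mcomp (fun i => mcomp h' (h i)) P.
Proof.
rewrite /mcomp rmorph_mmap /=; congr mmap.
by apply: functional_extensionality => c /=; rewrite mmapC.
Qed.

Lemma mcoeff_trunc n N (g : mps n A) m :
  (mps_trunc N g)@_m = if (mdeg m < N)%N then g m else 0.
Proof.
rewrite /mps_trunc raddf_sum /=; case: ifP => [mN|/negbT mN].
  rewrite (bigD1 (BMultinom mN)) //= mcoeffZ mcoeffX eqxx mulr1 big1 ?addr0 //.
  by move=> m' nm; rewrite mcoeffZ mcoeffX -(inj_eq val_inj) /= in nm *;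
     rewrite (negPf nm) mulr0.
rewrite big1 // => m' _; rewrite mcoeffZ mcoeffX.
case: eqP => [mm|]; last by rewrite mulr0.
by case/negP: mN; rewrite -mm bmdeg.
Qed.

Lemma mord_ge_trunc n N (g : mps n A) : g 0%MM = 0 -> mord_ge 1 (mps_trunc N g).
Proof.
move=> g0 m; rewrite ltnS leqn0 mdeg_eq0 => /eqP ->.
by rewrite mcoeff_trunc g0 if_same.
Qed.

Lemma mps_compE n k (g : mps n A) (hs : 'I_n -> mps k A) m :
  mps_comp g hs m =
  (mcomp (fun i => mps_trunc (mdeg m).+1 (hs i)) (mps_trunc (mdeg m).+1 g))@_m.
Proof.
rewrite /mps_comp /comp_mpoly /mcomp; congr (mmap _ _ _)@__.
by apply: functional_extensionality => i; rewrite tnth_mktuple.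
Qed.

(** [mps_comp] truncates at a degree depending on the coefficient asked for; this trades it for one
    uniform [N], so that facts on polynomial substitution transfer to series. *)
Lemma mord_ge_trunc_comp n k N (g : mps n A) (hs : 'I_n -> mps k A) :
  (forall i, hs i 0%MM = 0) ->
  mord_ge N (mcomp (fun i => mps_trunc N (hs i)) (mps_trunc N g)
         - mps_trunc N (mps_comp g hs)).
Proof.
move=> hs0 m mN; rewrite mcoeffB mcoeff_trunc mN mps_compE.
have trunc_ord l (h : mps l A) :
    mord_ge (mdeg m).+1 (mps_trunc N h - mps_trunc (mdeg m).+1 h).
  move=> m' m'm; rewrite mcoeffB !mcoeff_trunc m'm ifT ?subrr //.
  by rewrite (leq_trans m'm).
rewrite -mcoeffB; suff: mord_ge (mdeg m).+1
   (mcomp (fun i => mps_trunc N (hs i)) (mps_trunc N g) -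
    mcomp (fun i => mps_trunc (mdeg m).+1 (hs i)) (mps_trunc (mdeg m).+1 g)).
  by apply.
apply: (@mord_ge_trans _ _ _
  (mcomp (fun i => mps_trunc (mdeg m).+1 (hs i)) (mps_trunc N g))).
  by apply: mcomp_cong => i.
by rewrite -mcompB; apply: mord_ge_mcomp => // i; apply: mord_ge_trunc.
Qed.

Lemma mps_compA n k l (g : mps n A) (hs : 'I_n -> mps k A) (ks : 'I_k -> mps l A) :
  (forall i, hs i 0%MM = 0) -> (forall i, ks i 0%MM = 0) ->
  mps_comp (mps_comp g hs) ks = mps_comp g (fun i => mps_comp (hs i) ks).
Proof.
move=> hs0 ks0; apply: functional_extensionality => m; rewrite !mps_compE.
set N := (mdeg m).+1; apply/eqP; rewrite -subr_eq0 -mcoeffB; apply/eqP.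
suff: mord_ge N (mcomp (fun i => mps_trunc N (ks i)) (mps_trunc N (mps_comp g hs))
  - mcomp (fun i => mps_trunc N (mps_comp (hs i) ks)) (mps_trunc N g)).
  by apply; rewrite ltnSn.
set kN := fun i => _.
apply: (@mord_ge_trans _ _ _
  (mcomp kN (mcomp (fun i => mps_trunc N (hs i)) (mps_trunc N g)))).
  rewrite -mcompB; apply: mord_ge_mcomp => [i|]; first exact: mord_ge_trunc.
  by rewrite -opprB; apply: mord_geN; apply: mord_ge_trunc_comp.
by rewrite mcompA; apply: mcomp_cong => i; apply: mord_ge_trunc_comp.
Qed.

Lemma mps_truncD n N (g h : mps n A) :
  mps_trunc N (fun m => g m + h m) = mps_trunc N g + mps_trunc N h.
Proof.
by apply/mpolyP => m; rewrite mcoeffD !mcoeff_trunc; case: ifP; rewrite ?addr0.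
Qed.

Lemma mps_truncZ n N a (g : mps n A) :
  mps_trunc N (fun m => a * g m) = a *: mps_trunc N g.
Proof.
by apply/mpolyP => m; rewrite mcoeffZ !mcoeff_trunc; case: ifP; rewrite ?mulr0.
Qed.

Lemma mps_compDl n k (g g' : mps n A) (hs : 'I_n -> mps k A) :
  mps_comp (fun m => g m + g' m) hs =
  fun m => mps_comp g hs m + mps_comp g' hs m.
Proof.
apply: functional_extensionality => m.
by rewrite !mps_compE mps_truncD [mcomp _ _]mmapD mcoeffD.
Qed.

Lemma mps_compZl n k a (g : mps n A) (hs : 'I_n -> mps k A) :
  mps_comp (fun m => a * g m) hs = fun m => a * mps_comp g hs m.
Proof.
apply: functional_extensionality => m.
by rewrite !mps_compE mps_truncZ [mcomp _ _]mmapZ mcoeffCM.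
Qed.

Lemma mps_comp_var n k i (hs : 'I_n -> mps k A) :
  hs i 0%MM = 0 -> mps_comp (mps_var A i) hs = hs i.
Proof.
move=> hi0; apply: functional_extensionality => m; rewrite mps_compE.
(* At the zero exponent the truncation degree is 1, which kills the variable itself; hence the
   separate case. *)
have [->|m0] := eqVneq m 0%MM.
  rewrite hi0 mdeg0.
  suff -> : mps_trunc 1 (mps_var A i) = 0 by rewrite [mcomp _ _]mmap0 mcoeff0.
  apply/mpolyP => m'; rewrite mcoeff_trunc mcoeff0 ltnS leqn0 mdeg_eq0.
  case: eqP => // ->; rewrite /mps_var eq_sym -mdeg_eq0 mdeg1 //.
suff -> : mps_trunc (mdeg m).+1 (mps_var A i) = 'X_i.
  by rewrite [mcomp _ _]mmapX mmap1U mcoeff_trunc ltnSn.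
apply/mpolyP => m'; rewrite mcoeff_trunc mcoeffX /mps_var [in RHS]eq_sym.
case: eqP => [->|]; last by rewrite if_same.
by rewrite mdeg1 ltnS lt0n mdeg_eq0 m0.
Qed.

Lemma mps_comp0 n k (g : mps n A) (hs : 'I_n -> mps k A) :
  mps_comp g hs 0%MM = g 0%MM.
Proof.
rewrite mps_compE mdeg0.
have -> : mps_trunc 1 g = (g 0%MM)%:MP.
  apply/mpolyP => m; rewrite mcoeff_trunc mcoeffC ltnS leqn0 mdeg_eq0.
  by case: eqP => [->|]; rewrite ?mulr1 ?mulr0.
by rewrite [mcomp _ _]mmapC mcoeffC eqxx mulr1.
Qed.

Lemma trunc_mps1 N (f : nat -> A) :
  mps_trunc N (mps1 f) = \sum_(i < N) f i *: 'X_ord0 ^+ i.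
Proof.
apply/mpolyP => m; rewrite mcoeff_trunc raddf_sum /=.
have XE i : ('X_(ord0 : 'I_1) ^+ i : {mpoly A[1]})@_m = (i == mdeg m)%:R.
  rewrite mpolyXn mcoeffX; congr (nat_of_bool _)%:R.
  apply/eqP/eqP => [<-|->]; first by rewrite mdegMn mdeg1 mul1n.
  by apply/mnmP => k; rewrite (ord1 k) mulmnE mnm1E eqxx mul1n mdegE big_ord1.
under eq_bigr => i _ do rewrite mcoeffZ XE.
case: ltnP => [mN|Nm].
  rewrite (bigD1 (Ordinal mN)) //= eqxx mulr1 big1 ?addr0 // => i.
  by rewrite -(inj_eq val_inj) /= => /negPf ->; rewrite mulr0.
by rewrite big1 // => i _; rewrite ltn_eqF ?mulr0 // (leq_trans (ltn_ord i)).
Qed.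

Lemma mcomp_mps1 k N (f : nat -> A) (P : 'I_1 -> {mpoly A[k]}) :
  mcomp P (mps_trunc N (mps1 f)) = \sum_(i < N) f i *: P ord0 ^+ i.
Proof.
rewrite trunc_mps1 [LHS]raddf_sum; apply: eq_bigr => i _ /=.
by rewrite mmapZ mul_mpolyC rmorphXn /= mmapX mmap1U.
Qed.

(** Bridge to univariate polynomials, in which Honda's argument is carried out; [rho] below
    identifies the two polynomial rings and preserves degrees. *)
Lemma mps1_comp (f g : nat -> A) m :
  mps_comp (mps1 f) (args1 (mps1 g)) m =
  ((\poly_(i < (mdeg m).+1) f i) \Po (\poly_(i < (mdeg m).+1) g i))`_(mdeg m).
Proof.
rewrite mps_compE mcomp_mps1 poly_comp_sum; set N := (mdeg m).+1.
pose rho := mmap (@polyC A) (fun _ : 'I_1 => 'X).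
have rhoE (P : {mpoly A[1]}) : P@_m = (rho P)`_(mdeg m).
  rewrite {1}[P]mpolyE /rho /mmap raddf_sum coef_sum; apply: eq_bigr => m' _ /=.
  rewrite mcoeffZ mcoeffX coefCM /mmap1 big_ord1 coefXn; congr (_ * (nat_of_bool _)%:R).
  have mdegE1 (x : 'X_{1..1}) : mdeg x = x ord0 by rewrite mdegE big_ord1.
  rewrite -mdegE1 eq_sym; apply/eqP/eqP => [->//|].
  rewrite !mdegE1 => mm; apply/mnmP => i.
  by rewrite (ord1 i).
rewrite rhoE; apply: (congr1 (fun P : {poly A} => P`_(mdeg m))).
rewrite /rho raddf_sum; apply: eq_bigr => i _ /=.
rewrite mmapZ mul_polyC rmorphXn /=; congr (_ *: _ ^+ _).
rewrite /args1 trunc_mps1 raddf_sum poly_def; apply: eq_bigr => l _ /=.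
by rewrite mmapZ mul_polyC rmorphXn /= mmapX mmap1U.
Qed.

(** Induction on the degree: once [P] and [Q] agree below degree [d], the powers from the second on
    agree through degree [d], so [f 1 = 1] isolates the coefficients of degree [d]. *)
Lemma mps_comp_inj k (f : nat -> A) (P Q : mps k A) :
  f 1%N = 1 -> P 0%MM = 0 -> Q 0%MM = 0 ->
  mps_comp (mps1 f) (args1 P) = mps_comp (mps1 f) (args1 Q) -> P = Q.
Proof.
move=> f1 P0 Q0 fPQ; apply: functional_extensionality => m.
have [d] := ubnP (mdeg m); elim: d m => // d IHd m; rewrite ltnS => md.
have [->|m0] := eqVneq m 0%MM; first by rewrite P0 Q0.
have := congr1 (fun g => g m) fPQ; rewrite /= !mps_compE !mcomp_mps1 /args1.
set N := (mdeg m).+1; set X := mps_trunc N P; set Y := mps_trunc N Q.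
have XY : mord_ge (mdeg m) (X - Y).
  move=> m' m'm; rewrite mcoeffB !mcoeff_trunc IHd ?subrr //.
  exact: leq_trans m'm md.
have m_gt0 : (0 < mdeg m)%N by rewrite lt0n mdeg_eq0.
move/eqP; rewrite -subr_eq0 -mcoeffB -sumrB raddf_sum /=.
rewrite (bigD1 (Ordinal (m_gt0 : (1 < N)%N))) //= big1 => [|i i1]; last first.
  move: i1; rewrite -scalerBr mcoeffZ -(inj_eq val_inj) /=.
  case: (nat_of_ord i) => [|[|j]] // _; first by rewrite !expr0 subrr mcoeff0 mulr0.
  suff H : mord_ge N (X ^+ j.+2 - Y ^+ j.+2) by rewrite H ?mulr0 /N.
  rewrite subrXX /N -addn1; apply: mord_geM => //.
  elim/big_ind: _ => [||l _]; first exact: mord_ge0.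
    by move=> x y; apply: mord_geD.
  (* Every summand of the cofactor contains a factor [X] or [Y], hence has order at least 1. *)
  case: l => -[|l] li /=.
    by rewrite expr0 mulr1 ?subn0 exprS; apply: mord_ge_mulr; apply: mord_ge_trunc.
  by rewrite [Y ^+ _]exprS mulrCA; apply: mord_ge_mulr; apply: mord_ge_trunc.
rewrite f1 !scale1r !expr1 addr0 mcoeffB !mcoeff_trunc ltnSn subr_eq0.
by move/eqP.
Qed.

Lemma trunc_over (S : subringClosed A) n N (g : mps n A) :
  (forall m, g m \in S) -> mps_trunc N g \is a mpolyOver n S.
Proof.
move=> gS; apply/mpolyOverP => m; rewrite mcoeff_trunc.
by case: ifP => _; rewrite ?rpred0.
Qed.

Lemma mcomp_over (S : subringClosed A) n k (h : 'I_n -> {mpoly A[k]}) P :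
  P \is a mpolyOver n S -> (forall i, h i \is a mpolyOver k S) ->
  mcomp h P \is a mpolyOver k S.
Proof.
move=> /mpolyOverP PS hS.
apply: (@mmap_stable _ _ (fun P => P \is a mpolyOver k S)) => [||||m|//].
- exact: rpred0.
- exact: rpred1.
- by move=> x y; apply: rpredD.
- by move=> x y; apply: rpredM.
- by rewrite mpolyOverC.
Qed.

Lemma mps_comp_over (S : subringClosed A) n k (g : mps n A) (hs : 'I_n -> mps k A) :
  (forall m, g m \in S) -> (forall i m, hs i m \in S) ->
  forall m, mps_comp g hs m \in S.
Proof.
move=> gS hS m; rewrite mps_compE.
by apply/mpolyOverP/mcomp_over => [|i]; apply: trunc_over.
Qed.

End OrderFiltration.

(** * Evaluation of power series *)

Lemma positive_lower_bound n (d : 'I_n -> rat) :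
  (forall i, 0 < d i) -> exists2 c, 0 < c & forall i, c <= d i.
Proof.
elim: n d => [|n IHn] d d0; first by exists 1 => [|[]].
have [c c0 cd] := IHn (fun i => d (lift ord0 i)) (fun i => d0 _).
exists (Num.min c (d ord0)) => [|i]; first by rewrite lt_min c0 d0.
by case: (unliftP ord0 i) => [k|] ->; rewrite ge_min ?cd ?lexx ?orbT.
Qed.

Section Evaluation.
Variables (A O M : fieldType) (v : O -> rat).
Variables (j : {rmorphism A -> O}) (e : {rmorphism M -> O}).
Hypotheses (v_val : is_valuation v) (M_complete : v_complete (v \o e)).
Hypothesis j_e : forall a, exists y, j a = e y.
Variable S : subringClosed A.
Hypothesis S_int : forall a, a \in S -> in_O v (j a).

Local Notation Pt := (fg_points v e).

Let in_OM (x y : O) : in_O v x -> in_O v y -> in_O v (x * y).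
Proof. by move=> x0 y0; rewrite /in_O -[0]addr0 val_geM. Qed.

Let in_O1 : in_O v 1. Proof. by rewrite /in_O /val_ge val1 // lexx orbT. Qed.

Lemma points_bound n (x : 'I_n -> O) : (forall i, in_p v (x i)) ->
  exists2 c, 0 < c & forall i, val_ge v c (x i).
Proof.
move=> xp; have ex i : exists d, 0 < d /\ val_ge v d (x i).
  by have [c c0 cx] := in_p_val_ge (xp i); exists c.
have [d dx] := choice _ ex.
have [c c0 cd] := positive_lower_bound (fun i => (dx i).1).
by exists c => // i; apply: val_geW (dx i).2.
Qed.

Lemma psumE n (g : mps n A) (x : 'I_n -> O) N :
  mps_psum j g x N = mmap j x (mps_trunc N g).
Proof.
rewrite /mps_trunc raddf_sum; apply: eq_bigr => m _ /=.
by rewrite mmapZ mmapX.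
Qed.

Lemma trunc_int n N (g : mps n A) m :
  (forall m, g m \in S) -> in_O v (j (mps_trunc N g)@_m).
Proof.
move=> gS; rewrite mcoeff_trunc; case: ifP => _; first exact: S_int.
by rewrite rmorph0; apply: val_ge0.
Qed.

(** The link between the two filtrations: a monomial of degree [d] has valuation at least [c d] at
    [x]. All convergence rates below come from it. *)
Lemma val_mmap_mord_ge n c N (P : {mpoly A[n]}) (x : 'I_n -> O) :
  0 <= c -> (forall i, val_ge v c (x i)) -> (forall m, in_O v (j P@_m)) ->
  mord_ge N P -> val_ge v (c *+ N) (mmap j x P).
Proof.
move=> c0 cx PO NP; apply: val_ge_sum => // m _.
have [mN|Nm] := ltnP (mdeg m) N; first by rewrite NP // rmorph0 mul0r val_ge0.
apply: (val_geW (c := 0 + c *+ mdeg m)); first by rewrite add0r ler_wpMn2l.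
apply: val_geM => //; first exact: PO.
rewrite mdegE /mmap1; elim/big_ind2: _ => [|k y l z ky lz|i _].
- by rewrite mulr0n; apply: in_O1.
- by rewrite mulrnDr; apply: val_geM.
- exact: val_geX.
Qed.

Section Series.
Variables (n : nat) (g : mps n A) (x : 'I_n -> O).
Hypotheses (gS : forall m, g m \in S) (xP : forall i, Pt (x i)).

Lemma psum_diff c N N' : 0 <= c -> (forall i, val_ge v c (x i)) -> (N <= N')%N ->
  val_ge v (c *+ N) (mps_psum j g x N' - mps_psum j g x N).
Proof.
move=> c0 cx NN'; rewrite !psumE -mmapB; apply: val_mmap_mord_ge => // m.
  by rewrite mcoeffB rmorphB; apply: val_geB => //; apply: trunc_int.
by move=> mN; rewrite mcoeffB !mcoeff_trunc mN (leq_trans mN NN') subrr.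
Qed.

Lemma eval_cvg : v_cvg v (mps_psum j g x) (mps_eval v j g x) /\
  exists y, mps_eval v j g x = e y.
Proof.
have [c c0 cx] := points_bound (fun i => (xP i).1).
(* Completeness is available in [M] only, so the partial sums are pulled back along [e] before a
   limit is taken. *)
have psum_e N : exists y, mps_psum j g x N = e y.
  rewrite psumE; apply: (@mmap_stable _ _ (fun z => exists y, z = e y)) => //.
  - by exists 0; rewrite rmorph0.
  - by exists 1; rewrite rmorph1.
  - by move=> _ _ [y ->] [z ->]; exists (y + z); rewrite rmorphD.
  - by move=> _ _ [y ->] [z ->]; exists (y * z); rewrite rmorphM.
  - by move=> i; case: (xP i).
have [s sE] := choice _ psum_e.
have [d|l sl] := M_complete (s := s).
  have [N0 HN] := rat_natmul_ge d c0; exists N0 => m m' mN m'N.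
  rewrite val_ge_comp rmorphB -!sE.
  wlog mm' : m m' mN m'N / (m' <= m)%N.
    by move=> WL; case/orP: (leq_total m' m) => /WL; last rewrite val_geBC //; apply.
  apply: val_geW (psum_diff (ltW c0) cx mm').
  exact: HN.
have psum_l : v_cvg v (mps_psum j g x) (e l).
  move=> d; have [N0 HN] := sl d; exists N0 => N /HN.
  by rewrite val_ge_comp rmorphB -sE.
have cvg_eval : v_cvg v (mps_psum j g x) (mps_eval v j g x).
  by apply: epsilon_spec; exists (e l).
by split=> //; exists l; apply: v_cvg_unique cvg_eval psum_l.
Qed.

Lemma eval_near c N : 0 <= c -> (forall i, val_ge v c (x i)) ->
  val_ge v (c *+ N) (mps_eval v j g x - mps_psum j g x N).
Proof.
move=> c0 cx; have [/(_ (c *+ N))[N0 HN] _] := eval_cvg.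
apply: (val_ge_trans v_val (y := mps_psum j g x (maxn N0 N))).
  by rewrite val_geBC // HN // leq_maxl.
by apply: psum_diff => //; apply: leq_maxr.
Qed.

Lemma eval_val_ge c : 0 <= c -> (forall i, val_ge v c (x i)) -> g 0%MM = 0 ->
  val_ge v c (mps_eval v j g x).
Proof.
move=> c0 cx g0; rewrite -[mps_eval _ _ _ _](subrK (mps_psum j g x 1)).
apply: val_geD => //; first by rewrite -[c]mulr1n; apply: eval_near.
rewrite -[c]mulr1n psumE; apply: val_mmap_mord_ge => // [m|].
  exact: trunc_int.
exact: mord_ge_trunc.
Qed.

Lemma eval_point : g 0%MM = 0 -> Pt (mps_eval v j g x).
Proof.
move=> g0; split; last by case: eval_cvg.
have [c c0 cx] := points_bound (fun i => (xP i).1).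
exact/(val_ge_in_p c0)/eval_val_ge/g0/cx/ltW.
Qed.

End Series.

Lemma eval_var n i (x : 'I_n -> O) : mps_eval v j (mps_var A i) x = x i.
Proof.
have cvg_xi : v_cvg v (mps_psum j (mps_var A i) x) (x i).
  move=> c; exists 2%N => N N2; rewrite psumE.
  suff -> : mps_trunc N (mps_var A i) = 'X_i.
    by rewrite mmapX mmap1U subrr val_ge0.
  apply/mpolyP => m; rewrite mcoeff_trunc mcoeffX /mps_var [in RHS]eq_sym.
  by case: eqP => [->|]; rewrite ?if_same // mdeg1 N2.
apply: (v_cvg_unique v_val (s := mps_psum j (mps_var A i) x)) => //.
by apply: epsilon_spec; exists (x i).
Qed.

Lemma eval_zero n (x : 'I_n -> O) : mps_eval v j (mps_zero A n) x = 0.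
Proof.
have cvg0 : v_cvg v (mps_psum j (mps_zero A n) x) 0.
  move=> c; exists 0%N => N _; rewrite /mps_psum big1 ?subrr ?val_ge0 // => m _.
  by rewrite rmorph0 mul0r.
apply: (v_cvg_unique v_val (s := mps_psum j (mps_zero A n) x)) => //.
by apply: epsilon_spec; exists 0.
Qed.

(** Both sides are compared with the value of the composite of the [N]-truncations; each
    intermediate error has valuation at least [c N], and [N] is arbitrary. *)
Lemma eval_comp n k (g : mps n A) (hs : 'I_n -> mps k A) (x : 'I_k -> O) :
  (forall m, g m \in S) -> (forall i m, hs i m \in S) ->
  (forall i, hs i 0%MM = 0) -> (forall i, Pt (x i)) ->
  mps_eval v j (mps_comp g hs) x =
  mps_eval v j g (fun i => mps_eval v j (hs i) x).
Proof.
move=> gS hS hs0 xP.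
have [c c0 cx] := points_bound (fun i => (xP i).1); have c0' := ltW c0.
set y := fun i => mps_eval v j (hs i) x.
have yP i : Pt (y i) by apply: eval_point.
have cy i : val_ge v c (y i) by apply: eval_val_ge.
have compS := mps_comp_over gS hS.
apply/eqP; rewrite -subr_eq0; apply/eqP; apply: (@val_ge_eq0 _ v) => d.
have [N HN] := rat_natmul_ge d c0; apply: (val_geW (HN N (leqnn N))).
pose hN i := mps_trunc N (hs i); pose gN := mps_trunc N g.
apply: (val_ge_trans v_val (y := mps_psum j (mps_comp g hs) x N)).
  exact: eval_near.
apply: (val_ge_trans v_val (y := mmap j x (mcomp hN gN))).
  rewrite psumE -mmapB; apply: val_mmap_mord_ge => // [m|].
    rewrite mcoeffB rmorphB; apply: val_geB => //; first exact: trunc_int.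
    suff SC : mcomp hN gN \is a mpolyOver k S by apply/S_int; move/mpolyOverP: SC.
    apply: mcomp_over; first exact: trunc_over.
    by move=> i; apply: trunc_over.
  by rewrite -opprB; apply/mord_geN/mord_ge_trunc_comp.
apply: (val_ge_trans v_val (y := mmap j y gN)); last first.
  by rewrite val_geBC // -psumE; apply: eval_near.
have -> : mmap j x (mcomp hN gN) = mmap j (fun i => mmap j x (hN i)) gN.
  rewrite /mcomp rmorph_mmap /=; congr mmap.
  by apply: functional_extensionality => a /=; rewrite mmapC.
apply: (@mmap_cong _ _ (in_O v) (val_ge v (c *+ N))) => [|||||m|i|i|i].
- exact: in_O1.
- exact: in_OM.
- exact: val_ge0.
- by move=> a b; apply: val_geD.
- by move=> a b a0 b0; rewrite -[c *+ N]add0r; apply: val_geM.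
- exact: trunc_int.
(* The truncated value is integral as the limit [y i] minus a small error. *)
- rewrite /hN -psumE -[mps_psum _ _ _ _](subKr (y i)).
  apply: val_geB => //; first exact: val_geW c0' (cy i).
  apply: (val_geW (c := c *+ N)); first exact: mulrn_wge0.
  exact: eval_near.
- exact: val_geW c0' (cy i).
- by rewrite val_geBC // /hN -psumE; apply: eval_near.
Qed.

End Evaluation.

(** * The formal module *)

Lemma args2_map (T U : Type) (G : T -> U) a b :
  (fun i => G (args2 a b i)) = args2 (G a) (G b).
Proof. by apply: functional_extensionality => i; rewrite /args2; case: ifP. Qed.

Lemma args2_all (T : Type) (Q : T -> Prop) a b : Q a -> Q b -> forall i, Q (args2 a b i).
Proof. by move=> Qa Qb i; rewrite /args2; case: ifP. Qed.

Section FormalModule.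
Variables (A : fieldType) (w : A -> rat) (F : mps 2 A) (f : nat -> A).
Hypotheses (F_group : formal_group w F) (F_log : is_log F f).

Let X0 : mps 2 A := mps_var A (ord0 : 'I_2).
Let X1 : mps 2 A := mps_var A (ord_max : 'I_2).

Local Notation mul a := (mps1 (fg_mult f a)).
Local Notation logc P := (mps_comp (mps1 f) (args1 P)).

Lemma mps_var0 n (i : 'I_n) : mps_var A i 0%MM = 0.
Proof. by rewrite /mps_var eq_sym -mdeg_eq0 mdeg1. Qed.

Lemma F_coef0 : F 0%MM = 0.
Proof.
case: F_group => _ /(_ 0%MM) F0 _ _ _.
by move: F0; rewrite mps_comp0 mps_var0.
Qed.

Lemma fg_mult_spec a :
  fg_mult f a 0%N = 0 /\ logc (mul a) = mps1 (fun n => a * f n).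
Proof.
have [f0 f1 _] := F_log.
have [|g g0 fg] := comp_solve (b := fun n => a * f n) f0 f1.
  by rewrite f0 mulr0.
have ex_g : exists g, g 0%N = 0 /\ logc (mps1 g) =1 mps1 (fun n => a * f n).
  by exists g; split=> // m; rewrite mps1_comp fg.
have [g0' fE] := epsilon_spec (inhabits (fun _ => 0)) _ ex_g.
by split=> //; apply: functional_extensionality.
Qed.

Lemma mul_coef0 a : mul a 0%MM = 0.
Proof. by rewrite /mps1 mdeg0; case: (fg_mult_spec a). Qed.

(** Through [f], [[a]_F] becomes multiplication by [a] and, in [log_add], [F] becomes addition. With
    [mps_comp_inj] every module identity reduces to ring arithmetic. *)
Lemma log_mul a k (P : mps k A) : P 0%MM = 0 ->
  logc (mps_comp (mul a) (args1 P)) = fun m => a * logc P m.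
Proof.
move=> P0; rewrite -mps_compZl.
have [_ <-] : fg_mult f a 0%N = 0 /\
    logc (mul a) = (fun m => a * mps1 f m) := fg_mult_spec a.
by rewrite mps_compA // => i; apply: mul_coef0.
Qed.

Lemma log_add k (P Q : mps k A) : P 0%MM = 0 -> Q 0%MM = 0 ->
  logc (mps_comp F (args2 P Q)) = fun m => logc P m + logc Q m.
Proof.
move=> P0 Q0; have PQ0 i : args2 P Q i 0%MM = 0.
  by apply: (args2_all (Q := fun g : mps k A => g 0%MM = 0)).
have [_ _ /functional_extensionality logF] := F_log.
have -> : logc (mps_comp F (args2 P Q)) = mps_comp (logc F) (args2 P Q).
  by rewrite mps_compA // => i; apply: F_coef0.
have log_var i : mps_comp (logc (mps_var A i)) (args2 P Q) = logc (args2 P Q i).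
  rewrite mps_compA; [by rewrite /args1 mps_comp_var | | exact: PQ0].
  by move=> l; apply: mps_var0.
rewrite logF mps_compDl; apply: functional_extensionality => m.
by congr (_ + _); [apply: (congr1 (fun g => g m) (log_var ord0)) |
                   apply: (congr1 (fun g => g m) (log_var ord_max))].
Qed.

Lemma mul_add a : mps_comp (mul a) (args1 F) =
  mps_comp F (args2 (mps_comp (mul a) (args1 X0)) (mps_comp (mul a) (args1 X1))).
Proof.
have [_ f1 logF] := F_log.
have mulX0 i : mps_comp (mul a) (args1 (mps_var A (i : 'I_2))) 0%MM = 0.
  by rewrite mps_comp0 mul_coef0.
apply: (mps_comp_inj f1); first by rewrite mps_comp0 mul_coef0.
  by rewrite mps_comp0 F_coef0.
rewrite (log_mul a F_coef0) (log_add (mulX0 ord0) (mulX0 ord_max)).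
apply: functional_extensionality => m; rewrite logF mulrDr.
by congr (_ + _); rewrite log_mul //; apply: mps_var0.
Qed.

Lemma add_mul a b : mps_comp F (args2 (mul a) (mul b)) = mul (a + b).
Proof.
have [_ f1 _] := F_log.
apply: (mps_comp_inj f1); [by rewrite mps_comp0 F_coef0 | exact: mul_coef0 |].
rewrite (log_add (mul_coef0 a) (mul_coef0 b)).
rewrite (fg_mult_spec a).2 (fg_mult_spec b).2 (fg_mult_spec (a + b)).2.
by apply: functional_extensionality => m; rewrite /mps1 mulrDl.
Qed.

Lemma mul_mul a b : mps_comp (mul a) (args1 (mul b)) = mul (a * b).
Proof.
have [_ f1 _] := F_log.
apply: (mps_comp_inj f1); [by rewrite mps_comp0 mul_coef0 | exact: mul_coef0 |].
rewrite (log_mul a (mul_coef0 b)) (fg_mult_spec b).2 (fg_mult_spec (a * b)).2.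
by apply: functional_extensionality => m; rewrite /mps1 mulrA.
Qed.

Lemma mul_zero : mul 0 = mps_zero A 1.
Proof.
have [f0 f1 _] := F_log.
apply: (mps_comp_inj f1); [exact: mul_coef0 | by [] |].
rewrite (fg_mult_spec 0).2.
apply: functional_extensionality => m; rewrite mps_compE mcomp_mps1 /mps1 mul0r.
have -> : mps_trunc (mdeg m).+1 (mps_zero A 1) = 0.
  by apply/mpolyP => m'; rewrite mcoeff_trunc mcoeff0 if_same.
rewrite big_ord_recl f0 scale0r add0r big1 ?mcoeff0 // => i _.
by rewrite expr0n scaler0.
Qed.

(** * The module structure on the points with values in M *)

Variables (O M : fieldType) (v : O -> rat).
Variables (j : {rmorphism A -> O}) (e : {rmorphism M -> O}).
Hypotheses (v_val : is_valuation v) (M_complete : v_complete (v \o e)).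
Hypothesis j_e : forall a, exists y, j a = e y.
Variable S : subringClosed A.
Hypotheses (S_int : forall a, a \in S -> in_O v (j a)).
Hypothesis FS : forall m, F m \in S.

Local Notation Pt := (fg_points v e).
Local Notation "x <+> y" := (fg_add v j F x y) (at level 50, left associativity).
Local Notation scale a x := (fg_scale v j f a x).
Local Notation mul_int a := (forall n, fg_mult f a n \in S).

Let varS n (i : 'I_n) m : mps_var A i m \in S.
Proof. by rewrite /mps_var; case: eqP; rewrite ?rpred0 ?rpred1. Qed.

Let zeroS n m : mps_zero A n m \in S. Proof. exact: rpred0. Qed.

Let evalc := eval_comp v_val M_complete j_e S_int.
Let eval_pt := eval_point v_val M_complete j_e S_int.
Let evalX := @eval_var A O v j v_val.

Lemma point0 : Pt 0.
Proof. by split; [rewrite /in_p eqxx | exists 0; rewrite rmorph0]. Qed.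

Lemma point_add x y : Pt x -> Pt y -> Pt (x <+> y).
Proof. by move=> xP yP; apply: eval_pt FS _ F_coef0; apply: args2_all. Qed.

Lemma point_scale a x : mul_int a -> Pt x -> Pt (scale a x).
Proof. by move=> aS xP; apply: eval_pt (mul_coef0 a) => // m; apply: aS. Qed.

Let eval_add k (P Q : mps k A) (x : 'I_k -> O) :
  (forall m, P m \in S) -> (forall m, Q m \in S) ->
  P 0%MM = 0 -> Q 0%MM = 0 -> (forall i, Pt (x i)) ->
  mps_eval v j (mps_comp F (args2 P Q)) x = mps_eval v j P x <+> mps_eval v j Q x.
Proof.
move=> PS QS P0 Q0 xP; rewrite evalc //.
- by rewrite (args2_map (fun g => mps_eval v j g x)).
- by apply: (args2_all (Q := fun g : mps k A => forall m, g m \in S)).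
- by apply: (args2_all (Q := fun g : mps k A => g 0%MM = 0)).
Qed.

Let eval_mul a k (P : mps k A) (x : 'I_k -> O) : mul_int a ->
  (forall m, P m \in S) -> P 0%MM = 0 -> (forall i, Pt (x i)) ->
  mps_eval v j (mps_comp (mul a) (args1 P)) x = scale a (mps_eval v j P x).
Proof. by move=> aS PS P0 xP; rewrite evalc // => m; apply: aS. Qed.

Lemma fg_addx0 x : Pt x -> x <+> 0 = x.
Proof.
move=> xP; have [_ /functional_extensionality FX _ _ _] := F_group.
have := congr1 (fun g => mps_eval v j g (args1 x)) FX.
by rewrite /= eval_add ?evalX ?eval_zero ?mps_var0.
Qed.

Lemma fg_add0x x : Pt x -> 0 <+> x = x.
Proof.
move=> xP; have [_ _ /functional_extensionality FX _ _] := F_group.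
have := congr1 (fun g => mps_eval v j g (args1 x)) FX.
by rewrite /= eval_add ?evalX ?eval_zero ?mps_var0.
Qed.

Lemma fg_addC x y : Pt x -> Pt y -> x <+> y = y <+> x.
Proof.
move=> xP yP; have [_ _ _ _ /functional_extensionality FX] := F_group.
have := congr1 (fun g => mps_eval v j g (args2 y x)) FX.
rewrite /= eval_add ?evalX ?mps_var0 //.
by apply: args2_all.
Qed.

Lemma fg_addA x y z : Pt x -> Pt y -> Pt z -> x <+> y <+> z = x <+> (y <+> z).
Proof.
move=> xP yP zP; have [_ _ _ /functional_extensionality FX _] := F_group.
pose xs (i : 'I_3) := nth 0 [:: x; y; z] i.
have xsP i : Pt (xs i) by case: i => -[|[|[|]]].
have compS (i k : 'I_3) m : mps_comp F (args2 (mps_var A i) (mps_var A k)) m \in S.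
  by apply: mps_comp_over => //;
     apply: (args2_all (Q := fun g : mps 3 A => forall m, g m \in S)).
have := congr1 (fun g => mps_eval v j g xs) FX.
rewrite /= !eval_add ?mps_comp0 ?F_coef0 ?mps_var0 // !evalX /xs !inordK //.
Qed.

Lemma fg_scale0 a : mul_int a -> scale a 0 = 0.
Proof.
(* The point 0 meets every bound, hence so does its image; the maximum supplies the nonnegative
   bound required by [eval_val_ge]. *)
move=> aS; apply: (@val_ge_eq0 _ v) => c; apply: (@val_geW _ _ (Num.max c 0)).
  by rewrite le_max lexx.
apply: (eval_val_ge v_val M_complete j_e S_int) (mul_coef0 a) => // [m|i||i].
- exact: aS.
- exact: point0.
- by rewrite le_max lexx orbT.
- exact: val_ge0.
Qed.

Lemma fg_scaleDr a x y : mul_int a -> Pt x -> Pt y ->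
  scale a (x <+> y) = scale a x <+> scale a y.
Proof.
move=> aS xP yP; have xyP := args2_all (Q := Pt) xP yP.
have := congr1 (fun g => mps_eval v j g (args2 x y)) (mul_add a).
have mulS (i : 'I_2) m : mps_comp (mul a) (args1 (mps_var A i)) m \in S.
  by apply: mps_comp_over => [m'|l m']; [apply: aS | apply: varS].
have mulX i : mps_eval v j (mps_comp (mul a) (args1 (mps_var A i))) (args2 x y) =
    scale a (args2 x y i).
  by rewrite eval_mul ?evalX ?mps_var0.
rewrite /= eval_mul ?F_coef0 // eval_add ?mps_comp0 ?mul_coef0 //; try exact: mulS.
move=> H; rewrite -[scale a x](mulX ord0) -[scale a y](mulX ord_max).
exact: H.
Qed.

Lemma fg_scaleDl a b x : mul_int a -> mul_int b -> Pt x ->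
  scale a x <+> scale b x = scale (a + b) x.
Proof.
move=> aS bS xP.
have := congr1 (fun g => mps_eval v j g (args1 x)) (add_mul a b).
by rewrite /= eval_add ?mul_coef0 // => m; [apply: aS | apply: bS].
Qed.

Lemma fg_scaleM a b x : mul_int a -> mul_int b -> Pt x ->
  scale a (scale b x) = scale (a * b) x.
Proof.
move=> aS bS xP.
have := congr1 (fun g => mps_eval v j g (args1 x)) (mul_mul a b).
by rewrite /= eval_mul ?mul_coef0 // => m; apply: bS.
Qed.

Lemma fg_scale0l x : scale 0 x = 0.
Proof. by rewrite /fg_scale mul_zero eval_zero. Qed.

Local Notation lin a z := (fg_lincomb v j F f a z).

Lemma lincombS h (a : 'I_h.+1 -> A) (z : 'I_h.+1 -> O) :
  lin a z = scale (a ord0) (z ord0) <+>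
            lin (fun i => a (lift ord0 i)) (fun i => z (lift ord0 i)).
Proof. by rewrite /fg_lincomb big_ord_recl. Qed.

Lemma lincomb_point h (a : 'I_h -> A) z : (forall i, mul_int (a i)) ->
  (forall i, Pt (z i)) -> Pt (lin a z).
Proof.
elim: h a z => [|h IHh] a z aS zP; first by rewrite /fg_lincomb big_ord0; apply: point0.
by rewrite lincombS; apply: point_add; [apply: point_scale | apply: IHh].
Qed.

Lemma lincomb_eq0 h (a : 'I_h -> A) z :
  (forall i, scale (a i) (z i) = 0) -> lin a z = 0.
Proof.
elim: h a z => [|h IHh] a z az; first by rewrite /fg_lincomb big_ord0.
by rewrite lincombS az IHh // fg_addx0 //; apply: point0.
Qed.

Lemma lincombD h (a b : 'I_h -> A) z : (forall i, mul_int (a i)) ->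
  (forall i, mul_int (b i)) -> (forall i, Pt (z i)) ->
  lin a z <+> lin b z = lin (fun i => a i + b i) z.
Proof.
elim: h a b z => [|h IHh] a b z aS bS zP.
  by rewrite /fg_lincomb !big_ord0 fg_addx0 //; apply: point0.
rewrite !lincombS -IHh // -fg_scaleDl //.
set x1 := scale _ _; set x2 := scale _ _; set y1 := lin _ _; set y2 := lin _ _.
have x1P : Pt x1 by apply: point_scale.
have x2P : Pt x2 by apply: point_scale.
have y1P : Pt y1 by apply: lincomb_point.
have y2P : Pt y2 by apply: lincomb_point.
have adP := point_add.
rewrite fg_addA -?[y1 <+> (_ <+> _)]fg_addA; auto.
rewrite [y1 <+> x2]fg_addC // fg_addA ?fg_addA; auto.
Qed.

Lemma lincombZ h c (a : 'I_h -> A) z : mul_int c -> (forall i, mul_int (a i)) ->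
  (forall i, Pt (z i)) -> scale c (lin a z) = lin (fun i => c * a i) z.
Proof.
move=> cS; elim: h a z => [|h IHh] a z aS zP.
  by rewrite /fg_lincomb !big_ord0 fg_scale0.
rewrite !lincombS -IHh // -fg_scaleM // fg_scaleDr //.
  exact: point_scale.
exact: lincomb_point.
Qed.

(** The group law comes without an inverse operation; adding the combination with coefficients
    [- b i] to both sides replaces subtraction. *)
Lemma lincomb_sub h (a b : 'I_h -> A) z : (forall i, mul_int (a i)) ->
  (forall i, mul_int (- b i)) -> (forall i, mul_int (b i)) -> (forall i, Pt (z i)) ->
  lin a z = lin b z -> lin (fun i => a i - b i) z = 0.
Proof.
move=> aS bNS bS zP ab; rewrite -lincombD // ab lincombD //.
by apply: lincomb_eq0 => i; rewrite subrr fg_scale0l.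
Qed.

Lemma divisor_torsion h pi s (a : 'I_h -> A) z y :
  mul_int pi -> mul_int (pi ^+ s) -> (forall i, mul_int (a i)) ->
  (forall i, Pt (z i)) -> Pt y -> (forall i, scale (pi ^+ s) (z i) = 0) ->
  lin a z = scale pi y -> scale (pi ^+ s.+1) y = 0.
Proof.
move=> piS pisS aS zP yP zs0 azy.
rewrite exprSr -fg_scaleM // -azy lincombZ //; apply: lincomb_eq0 => i.
by rewrite mulrC -fg_scaleM // zs0 fg_scale0.
Qed.

End FormalModule.

Theorem lemma2p13
  (p : nat) (p_prime : prime p)
  (Qp : fieldType) (vp : Qp -> rat) (Qp_padic : is_Qp p vp)
  (K0 : fieldExtType Qp) (K : fieldExtType K0) (L : fieldExtType K)
  (M : splittingFieldType L)
  (Kalg : closedFieldType) (jM : {rmorphism M -> Kalg}) (v : Kalg -> rat)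
  (k0 : finFieldType) (red : K0 -> k0) (pi : K0)
  (phi : 'AEnd(K)) (F : mps 2 K) (f u : nat -> K)
  (m h s : nat) (zeta : 'I_h -> Kalg) :
  let jL : {rmorphism L -> Kalg} := emb jM in
  let jK : {rmorphism K -> Kalg} := emb jL in
  let jK0 : {rmorphism K0 -> Kalg} := emb jK in
  let jQp : {rmorphism Qp -> Kalg} := emb jK0 in
  let FpL := fg_points v jL in
  let FpM := fg_points v jM in
  let W := torsion v jK f pi%:A in
  let Winf := all_torsion v jK f pi%:A in
  (* Kalg is an algebraic closure of K, with the valuation extending vp *)
  (forall x : Kalg, algebraicOver jK x) ->
  is_valuation v ->
  (forall x : Qp, x != 0 -> v (jQp x) = vp x) ->
  uniformizer (v \o jK0) pi ->
  is_residue_field (v \o jK0) red ->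
  unramified (v \o jK0) (v \o jK) ->
  unramified (v \o jL) (v \o jM) ->
  galois 1%AS {:M}%AS ->
  #|'Gal({:M} / 1)%g| = (p ^ m)%N ->
  (* phi is the Frobenius of K / K0 *)
  (forall a : K, in_O (v \o jK) a -> in_p (v \o jK) (phi a - a ^+ #|k0|)) ->
  (* F is a Honda formal group of type u and height h, with logarithm f *)
  formal_group (v \o jK) F ->
  is_log F f ->
  is_type (v \o jK) pi%:A u ->
  honda_of_type (v \o jK) phi #|k0| pi%:A u f ->
  has_height (v \o jK) u h ->
  (0 < s)%N ->
  (forall x, Winf x /\ FpL x <-> W s x) ->
  (forall x, Winf x /\ FpM x <-> W s x) ->
  torsion_basis v jK F f (v \o jK0) pi s zeta ->
  k_independent v jK F f (v \o jK0) red
    (fun x => in_ker_ind v jK F f pi%:A FpL FpM (fg_coset v jK F f pi%:A FpL x))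
    zeta
  /\
  k_independent v jK F f (v \o jK0) red
    (fun x => forall y,
       fg_coset v jK F f pi%:A FpM x y <-> fg_coset v jK F f pi%:A FpM 0 y)
    zeta.
Proof.
move=> jL jK jK0 jQp FpL FpM W Winf _ v_val v_vp pi_unif k0_res K_unram _ _ _
  phi_frob F_group F_log [u0 uO] F_honda _ s_gt0 _ W_M [zetaW zeta_gen zeta_free].
have vK_val : is_valuation (v \o jK) := is_valuation_comp jK v_val.
have vK0_val : is_valuation (v \o jK0) := is_valuation_comp jK0 v_val.
have [_ vp_nat _ Qp_complete] := Qp_padic.
have M_complete : v_complete (v \o jM).
  apply: (finite_extension_complete (is_valuation_comp jM v_val)).
  apply: (finite_extension_complete (is_valuation_comp jL v_val)).
  apply: (finite_extension_complete (is_valuation_comp jK v_val)).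
  apply: (finite_extension_complete (is_valuation_comp jK0 v_val)).
  by apply: v_complete_eq Qp_complete => x /v_vp.
have jK_jM a : exists y, jK a = jM y by exists (in_alg M (in_alg L a)).
pose S : subringClosed K := HB.pack (in_O (v \o jK))
  (GRing.isSubringClosed.Build K (in_O (v \o jK)) (in_O_subring vK_val)).
have S_int a : a \in S -> in_O v (jK a) by rewrite -[in_O v _](val_ge_comp jK v).
have [pi0 pi_p pi_div] := pi_unif.
pose piK : K := pi%:A.
have piK0 : piK != 0 by rewrite scaler_eq0 oner_eq0 orbF.
(* As K/K0 is unramified, [x] has the valuation of some element of K0, so the uniformizer of K0 also
   serves for K. *)
have piK_div x : in_p (v \o jK) x -> x / piK \in S.
  have [->|x0 xp] := eqVneq x 0; first by rewrite mul0r rpred0.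
  have [y y0 yx] := K_unram x x0.
  have /pi_div : in_p (v \o jK0) y by move: xp; rewrite /in_p (negPf x0) (negPf y0) yx.
  have ypi0 : y / pi != 0 by rewrite mulf_neq0 ?invr_eq0.
  have xpi0 : x / piK != 0 by rewrite mulf_neq0 ?invr_eq0.
  rewrite [_ \in S]val_geE // [in_O _ _]val_geE //.
  by rewrite !valM ?invr_eq0 // !valV // yx.
have scalarS a : in_O (v \o jK0) a -> a%:A \in S.
  move=> aO; suff: in_O v (jK0 a) by rewrite [_ \in S](val_ge_comp jK v).
  by rewrite -[in_O v _](val_ge_comp jK0 v).
have piS : piK \in S by apply/scalarS/in_pW.
have p_gt0 := prime_gt0 p_prime.
have p_in_p : in_p v p%:R.
  have [p0 vp_p] := vp_nat p p_gt0.
  have -> : p%:R = jQp p%:R by rewrite rmorph_nat.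
  by rewrite /in_p v_vp // vp_p logn_prime // eqxx ltr01 orbT.
(* [p] has positive valuation and so reduces to 0: the residue field has characteristic [p], and
   having two distinct elements it has [r > 0]. *)
have [r r_gt0 q_eq] : exists2 r, (0 < r)%N & #|k0| = (p ^ r)%N.
  have [red1 redD _ _ red0] := k0_res.
  have O0 : in_O (v \o jK0) 0 by apply: val_ge0.
  have O1 : in_O (v \o jK0) 1 by rewrite /in_O /val_ge val1 // lexx orbT.
  have red_nat n : in_O (v \o jK0) n%:R /\ red n%:R = n%:R.
    elim: n => [|n [nO IHn]]; first by split=> //; apply/eqP; rewrite red0 // /in_p eqxx.
    by rewrite -addn1 !natrD; split; [apply: val_geD | rewrite redD // IHn red1].
  have p_char : p \in [pchar k0].
    rewrite inE p_prime -(red_nat p).2 red0; last by case: (red_nat p).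
    by rewrite in_p_comp rmorph_nat.
  have q_eq := card_pprimeChar p_char.
  set r := logn _ _ in q_eq; exists r => //.
  rewrite lt0n; apply/eqP => r0; have := finNzRing_gt1 k0.
  by rewrite q_eq r0.
have phi_scalar a : phi a%:A = a%:A by rewrite linearZ rmorph1.
have phiS x : x \in S -> phi x \in S.
  move=> xO; rewrite -[phi x](subrK (x ^+ #|k0|)).
  by rewrite rpredD ?rpredX //; apply/in_pW/phi_frob.
have [f0 f1 _] := F_log.
have mul_int a : in_O (v \o jK0) a -> forall n, fg_mult f a%:A n \in S.
  have [g0 fg] := fg_mult_spec F_log a%:A.
  move=> aO; apply: (honda_mult_integral (phi := phi) p_prime r_gt0 piK0 piS
    _ (phi_scalar pi) _ _ u0 uO f0 _ (scalarS _ aO) (phi_scalar a) f1 g0).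
  - by apply: piK_div; rewrite in_p_comp rmorph_nat.
  - exact: phiS.
  - by rewrite -q_eq => x xO; apply/piK_div/phi_frob.
  - by rewrite -q_eq; apply: F_honda.
  (* In one variable this exponent has degree [n], which turns the identity of series into one for
     the [n]-th coefficient. *)
  move=> n; have := congr1 (fun g => g (U_(ord0) *+ n)%MM) fg.
  by rewrite mps1_comp /mps1 mdegMn mdeg1 mul1n.
have FS m' : F m' \in S by case: F_group => FO _ _ _ _; apply: FO.
have zetaP i : FpM (zeta i) by case: (W_M (zeta i)) => _ /(_ (zetaW i)) [].
have O_scale n : in_O (v \o jK0) (pi ^+ n).
  by rewrite /in_O -[0](mul0rn _ n); apply: val_geX => //; apply: in_pW.
have OM a b : in_O (v \o jK0) a -> in_O (v \o jK0) b -> in_O (v \o jK0) (a * b).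
  by move=> aO bO; rewrite /in_O -[0]addr0; apply: val_geM.
have piX n : pi%:A ^+ n = (pi ^+ n)%:A :> K.
  by rewrite -[RHS]/(in_alg K _) rmorphXn.
have scalarM (a b : K0) : a%:A * b%:A = (a * b)%:A :> K.
  by rewrite -[RHS]/(in_alg K _) rmorphM.
have pi_mul_int := mul_int _ (O_scale 1%N).
have key (a : 'I_h -> K0) y : (forall i, in_O (v \o jK0) (a i)) -> FpM y ->
    fg_lincomb v jK F f (fun i => (a i)%:A) zeta = fg_scale v jK f pi%:A y ->
    forall i, red (a i) = 0.
  move=> aO yP ay.
  have yW : W s y.
    apply/W_M; split=> //; exists s.+1; split; first by case: yP.
    apply: (divisor_torsion F_group F_log v_val M_complete jK_jM S_int FS) ay => //.
    - by rewrite piX; apply: mul_int.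
    - by move=> i; apply: mul_int.
    - by move=> i; case: (zetaW i).
  have [b bO yE] := zeta_gen y yW.
  have aE i : in_O (v \o jK0) ((a i - pi * b i) / pi ^+ s).
    apply: (zeta_free (fun i => a i - pi * b i)) => [k|].
      by apply: val_geB => //; [apply: aO |];
         apply: OM; [apply: (O_scale 1%N) | apply: bO].
    have -> : (fun i => (a i - pi * b i)%:A) =
        (fun i => (a i)%:A - pi%:A * (b i)%:A) :> ('I_h -> K).
      by apply: functional_extensionality => k; rewrite scalarM scalerBl.
    apply: (lincomb_sub F_group F_log v_val M_complete jK_jM S_int FS) => // [k|k|k|].
    - exact: mul_int.
    - by rewrite scalarM -scaleNr; apply: mul_int; rewrite /in_O val_geN //;
         apply: OM; first exact: (O_scale 1%N).
    - by rewrite scalarM; apply: mul_int; apply: OM; first exact: (O_scale 1%N).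
    - rewrite ay yE (lincombZ F_group F_log v_val M_complete jK_jM S_int FS) // => k.
      exact: mul_int.
  move=> i; apply/eqP; case: k0_res => _ _ _ _ ->; last exact: aO.
  have [c c0 cpi] := in_p_val_ge pi_p; apply: (val_ge_in_p c0).
  (* Since [s >= 1], one [pi] can be split off [pi^s], which exhibits [a i] as [pi] times an
     integral element. *)
  have -> : a i = pi * ((a i - pi * b i) / pi ^+ s * pi ^+ s.-1 + b i).
    have pis0 : pi ^+ s.-1 != 0 by rewrite expf_neq0.
    by rewrite -{1}(prednK s_gt0) exprS; field; rewrite pis0 pi0.
  rewrite -[c]addr0; apply: val_geM => //; apply: val_geD => //; last exact: bO.
  exact: OM.
have lin_coset (a : 'I_h -> K0) : (forall i, in_O (v \o jK0) (a i)) ->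
    let x := fg_lincomb v jK F f (fun i => (a i)%:A) zeta in
    x = fg_add v jK F x (fg_scale v jK f pi%:A 0).
  move=> aO x; rewrite (fg_scale0 F_log v_val M_complete jK_jM S_int) //.
  rewrite (fg_addx0 F_group v_val M_complete jK_jM S_int FS) //.
  apply: (lincomb_point F_group F_log v_val M_complete jK_jM S_int FS) => // i.
  exact: mul_int.
have coset0 x : fg_coset v jK F f pi%:A FpM 0 x ->
    exists2 y, FpM y & x = fg_scale v jK f pi%:A y.
  move=> [_ [y [-> yP ->]]]; exists y => //.
  apply: (fg_add0x F_group v_val M_complete jK_jM S_int FS).
  exact: (point_scale F_log v_val M_complete jK_jM S_int).
have FpL0 : FpL 0 := point0 v jL.
have FpM0 : FpM 0 := point0 v jM.
split=> c a ac zero_a i; have aO i' : in_O (v \o jK0) (a i') := (ac i').1.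
  have [y yP ay] : exists2 y, FpM y &
      fg_lincomb v jK F f (fun i => (a i)%:A) zeta = fg_scale v jK f pi%:A y.
    (* The image of the class of [x] over M contains [x] itself, as [x] plus [[pi](0)] twice, once
       from L and once from M; that image being the zero coset, [x] lies in [[pi]F(p_M)]. *)
    apply: coset0; apply/zero_a.2; set x := fg_lincomb _ _ _ _ _ _.
    exists x, 0; split=> //; last exact: lin_coset.
    by exists x, 0; split=> //; apply: lin_coset.
  by rewrite -(ac i).2; apply: key ay i.
have [y yP ay] : exists2 y, FpM y &
    fg_lincomb v jK F f (fun i => (a i)%:A) zeta = fg_scale v jK f pi%:A y.
  apply: coset0; apply/zero_a; set x := fg_lincomb _ _ _ _ _ _.
  by exists x, 0; split=> //; apply: lin_coset.
by rewrite -(ac i).2; apply: key ay i.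
Qed.
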